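(* Let $\Omega\subset\mathbb R^n$ be open, let $\boldsymbol F\in\mathcal{DM}^{\mathrm{ext}}(\Omega)$ and let $E\subset\Omega$ be any Borel set. Then there exists a unique weakly${}^*$-continuous linear functional $\mathrm N_E(\boldsymbol F)\in \mathrm{Lip}_{\mathrm b}(\partial E)^*$ satisfying $$\langle \mathrm N_E(\boldsymbol F),\phi|_{\partial E}\rangle=-\int_E\nabla\phi\cdot \mathrm d\boldsymbol F-\int_E\phi\,\mathrm d(\operatorname{div}\boldsymbol F)\quad\text{for all }\phi\in C^1_{\mathrm b}(\Omega).$$
   Context: Throughout $n\ge 2$. For $\Omega\subset\mathbb R^n$ open, $\mathcal M(\Omega)$ (resp. $\mathcal M(\Omega;\mathbb R^n)$) is the space of finite signed (resp. $\mathbb R^n$-valued) Radon measures on $\Omega$. $\mathcal{DM}^{\mathrm{ext}}(\Omega)$ is the space of all $\boldsymbol F\in\mathcal M(\Omega;\mathbb R^n)$ for which there is a measure $\operatorname{div}\boldsymbol F\in\mathcal M(\Omega)$ with $\int_\Omega\nabla\phi\cdot\mathrm d\boldsymbol F=-\int_\Omega\phi\,\mathrm d(\operatorname{div}\boldsymbol F)$ for all $\phi\in C^1_{\mathrm c}(\Omega)$ (continuously differentiable functions with compact support in $\Omega$). $C^1_{\mathrm b}(\Omega)$ is the space of continuously differentiable functions on $\Omega$ that are bounded with bounded first derivatives. For $X\subset\mathbb R^n$, $\mathrm{Lip}_{\mathrm b}(X)$ is the space of bounded Lipschitz functions on $X$ with norm $\max\{\sup_X|\phi|,\mathrm{Lip}(\phi,X)\}$,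 where $\mathrm{Lip}(\phi,X)$ is the Lipschitz constant; $\mathrm{Lip}_{\mathrm b}(X)^*$ is its dual space. Any function in $\mathrm{Lip}_{\mathrm b}(\Omega)$ extends uniquely and continuously to $\overline\Omega$, and its restriction to $\partial E$ is understood through this extension when $\partial E\not\subset\Omega$. For $X\subset\mathbb R^n$ closed, the Arens–Eells space $\text{Æ}(X)$ is the completion (norm closure) in $\mathrm{Lip}_{\mathrm b}(X)^*$ of $\mathrm{span}\{\delta_x:x\in X\}$, where $\delta_x(\phi)=\phi(x)$. Via the pairing $(m,\phi)\mapsto m(\phi)$, $\mathrm{Lip}_{\mathrm b}(X)$ is identified with $\text{Æ}(X)^*$; the weak${}^*$ topology on $\mathrm{Lip}_{\mathrm b}(X)$ is the coarsest topology making $\phi\mapsto m(\phi)$ continuous for every $m\in\text{Æ}(X)$. $\partial E$ denotes the topological boundary of $E$ in $\mathbb R^n$.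
   Formalization: The identity is stated for those φ in C¹_b(Ω) whose limits from Ω exist at every point of ∂E and form a bounded Lipschitz function there; for other φ (e.g. jumping across a slit in Ω) the restriction to ∂E, hence the pairing, is undefined. *)

(* Defs.v *)
From HB Require Import structures.
From mathcomp Require Import all_boot all_order all_algebra.
From mathcomp Require Import all_classical all_reals all_analysis.

Set Implicit Arguments.
Unset Strict Implicit.
Unset Printing Implicit Defensive.

Import Order.TTheory GRing.Theory Num.Theory.
Import numFieldNormedType.Exports.

Local Open Scope classical_set_scope.
Local Open Scope ring_scope.

Section euclidean_space.
Context {R : realType} {n : nat}.

(* The library norm `|x| on 'rV[R]_n is the sup norm (with the same topology). *)
Definition enorm (x : 'rV[R]_n) : R := Num.sqrt (\sum_(i < n) x ord0 i ^+ 2).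

Definition boundary (E : set 'rV[R]_n) : set 'rV[R]_n := closure E `\` E°.

Definition partial (i : 'I_n) (phi : 'rV[R]_n -> R) : 'rV[R]_n -> R :=
  'D_(delta_mx ord0 i) phi.

(* Functions on an open set Omega are represented by functions on the whole
   space, of which only the values on Omega are ever used. *)
Definition C1 (Omega : set 'rV[R]_n) (phi : 'rV[R]_n -> R) : Prop :=
  (forall x, Omega x -> differentiable phi x) /\
  (forall i x, Omega x -> {for x, continuous (partial i phi)}).

Definition bounded_over (Omega : set 'rV[R]_n) (f : 'rV[R]_n -> R) : Prop :=
  exists M : R, forall x, Omega x -> `|f x| <= M.

Definition C1b (Omega : set 'rV[R]_n) (phi : 'rV[R]_n -> R) : Prop :=
  [/\ C1 Omega phi, bounded_over Omega phi &
      forall i, bounded_over Omega (partial i phi)].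

Definition C1c (Omega : set 'rV[R]_n) (phi : 'rV[R]_n -> R) : Prop :=
  let supp := closure [set x | Omega x /\ phi x != 0] in
  [/\ C1 Omega phi, compact supp & supp `<=` Omega].

End euclidean_space.

Notation Borel R n := (g_sigma_algebraType (@open 'rV[R]_n)).
Notation signed_measure R n := ({charge set (Borel R n) -> \bar R})%R.

Section divergence_measure_fields.
Context {R : realType} {n : nat}.
Implicit Types (Omega : set 'rV[R]_n) (nu : signed_measure R n)
  (F : 'I_n -> signed_measure R n).

(* A finite signed Radon measure on Omega is represented by its extension by 0
   to the Borel sets of the whole space; finite Borel measures on an open subset
   of R^n are Radon, and a charge only takes finite values. *)
Definition measure_on Omega nu : Prop :=
  forall A : set (Borel R n), measurable A -> A `&` Omega = set0 -> nu A = 0%E.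

Definition hahn_pos nu := projT1 (cid (Hahn_decomposition nu)).
Definition hahn_neg nu := projT1 (cid (projT2 (cid (Hahn_decomposition nu)))).
Definition hahnP nu : hahn_decomposition nu (hahn_pos nu) (hahn_neg nu) :=
  projT2 (cid (projT2 (cid (Hahn_decomposition nu)))).

(* Integral against a signed measure, through its Jordan decomposition. *)
Definition charge_integral nu (D : set (Borel R n)) (f : Borel R n -> R) : R :=
  Rintegral (jordan_pos (hahnP nu)) D f - Rintegral (jordan_neg (hahnP nu)) D f.

Definition grad_integral F (D : set 'rV[R]_n) (phi : 'rV[R]_n -> R) : R :=
  \sum_(i < n) charge_integral (F i) D (partial i phi).

Definition is_divergence Omega F nu : Prop :=
  measure_on Omega nu /\
  forall phi, C1c Omega phi ->
    grad_integral F Omega phi = - charge_integral nu Omega phi.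

Definition DMext Omega F : Prop :=
  (forall i, measure_on Omega (F i)) /\ exists nu, is_divergence Omega F nu.

(* The distributional divergence; meaningful for F in DMext Omega only, where its
   values on Borel sets are uniquely determined. *)
Definition divergence Omega F : signed_measure R n :=
  if pselect (exists nu, is_divergence Omega F nu) is left h
  then projT1 (cid h) else czero.

End divergence_measure_fields.

Section bounded_lipschitz_functions.
Context {R : realType} {n : nat}.
Variable X : set 'rV[R]_n.

Definition lipb : {pred X -> R} := mem [set f : X -> R |
  (exists M : R, forall x, `|f x| <= M) /\
  (exists L : R, forall x y, `|f x - f y| <= L * enorm (val x - val y))].

Definition lipb_key : pred_key lipb. Proof. exact. Qed.
Canonical lipb_keyed := KeyedPred lipb_key.

Record Lipb := MkLipb { lipb_fun :> X -> R; _ : lipb_fun \in lipb }.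

HB.instance Definition _ := [isSub for lipb_fun].
HB.instance Definition _ := [Choice of Lipb by <:].

Lemma lipb_submod_closed : submod_closed lipb.
Proof.
split.
  by rewrite inE; split; exists 0 => *; rewrite ?subrr normr0 ?mul0r.
move=> a f g; rewrite !inE => -[[Mf bf] [Lf lf]] [[Mg bg] [Lg lg]]; split.
  exists (`|a| * Mf + Mg) => x.
  by apply: (le_trans (ler_normD _ _)); rewrite lerD// normrM ler_wpM2l.
exists (`|a| * Lf + Lg) => x y.
have -> : (a *: f + g) x - (a *: f + g) y = a * (f x - f y) + (g x - g y).
  by rewrite mulrBr addrACA -opprD.
by apply: (le_trans (ler_normD _ _)); rewrite mulrDl -mulrA lerD// normrM ler_wpM2l.
Qed.

HB.instance Definition _ := GRing.isSubmodClosed.Build _ _ lipb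
  lipb_submod_closed.
HB.instance Definition _ := [SubChoice_isSubLmodule of Lipb by <:].

Definition sup_norm (f : Lipb) : R := sup [set `|f x| | x in [set: X]].

Definition lip_const (f : Lipb) : R :=
  sup [set `|f p.1 - f p.2| / enorm (val p.1 - val p.2)
      | p in [set p : X * X | p.1 != p.2]].

Definition lipb_norm (f : Lipb) : R := Num.max (sup_norm f) (lip_const f).

Definition lipb_dual : set (Lipb -> R) := [set m |
  linear (m : Lipb -> R^o) /\
  exists C : R, forall f : Lipb, `|m f| <= C * lipb_norm f].

Definition dual_norm (m : Lipb -> R) : R :=
  sup [set `|m f| | f in [set f | lipb_norm f <= 1]].

Definition dirac_span : set (Lipb -> R) := [set u |
  exists s : seq (R * X), forall f : Lipb, u f = \sum_(p <- s) p.1 * f p.2].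

Definition arens_eells : set (Lipb -> R) := [set m |
  lipb_dual m /\
  forall e : R, 0 < e -> exists2 u, dirac_span u & dual_norm (m \- u) < e].

(* Lipb with the weak* topology, i.e. the supremum of the initial topologies of
   the functionals f |-> m f for m in arens_eells. *)
Definition weak_star : Type :=
  sup_topology (fun m : arens_eells =>
    Topological.on (initial_topology (val m : Lipb -> R^o))).
HB.instance Definition _ := Topological.on weak_star.

End bounded_lipschitz_functions.

(* psi is the restriction to X of the continuous extension of phi from Omega to
   its closure (for X contained in that closure); at x in Omega this says
   psi x = phi x as soon as phi is continuous.  Every phi that is bounded and
   Lipschitz on Omega has such a psi; a function in C1b Omega may fail to be
   Lipschitz (even to have a Lipschitz restriction) when Omega is not convex, and
   its restriction is then an element of Lipb X only if some psi satisfies this. *)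
Definition is_restriction {R : realType} {n : nat} (Omega X : set 'rV[R]_n)
    (phi : 'rV[R]_n -> R) (psi : Lipb X) : Prop :=
  forall x : X, phi y @[y --> within Omega (nbhs (val x))] --> psi x.

(* Main.v *)
Require Import Defs.
From mathcomp Require Import all_boot all_order all_algebra.
From mathcomp Require Import all_classical all_reals all_analysis.
From mathcomp Require Import measurable_realfun.
From mathcomp Require Import ring lra.

Set Implicit Arguments.
Unset Strict Implicit.
Unset Printing Implicit Defensive.

Import Order.TTheory GRing.Theory Num.Theory.
Import numFieldNormedType.Exports.

Local Open Scope classical_set_scope.
Local Open Scope ring_scope.

(** Write N(phi) for minus the sum of the integrals of grad phi against F and of phi
    against div F, both over E.

    On functions of class C^1 that are bounded by K together with their first
    derivatives, N is continuous for locally uniform convergence.  To see this, choose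
    a C^1 function f with compact support in Omega that is close to the indicator of E
    in L^1 of the total variations of F and div F ([approximable_borel]).  The
    definition of div F applies to the product f phi and rewrites N(phi) as an error of
    size K times that L^1 distance plus the integral of phi grad f against F; the
    latter contains no derivative of phi ([normal_trace_split],
    [normal_trace_continuous]).

    Moreover N(phi) is small as soon as phi is small on a large bounded part of the
    boundary of E.  Truncate phi smoothly at height d and at infinity to get g, which
    vanishes near every point of the boundary.  Then g times the indicator of E is an
    admissible test function, so N(g) = 0 ([normal_trace_eq0]), while phi - g is
    uniformly small on a large ball; hence [normal_trace_boundary].

    A bounded Lipschitz function psi on the boundary extends to R^n ([mcshane_extension])
    and the extension is a locally uniform limit of C^1 functions whose values and
    derivatives are bounded by a constant times the norm of psi ([C1_approximation]).
    By the preceding estimate N converges along any such sequence, and the limit depends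
    on psi only ([trace_cvg]): it is the value of the functional at psi.  The functional
    is linear, bounded, and small at every psi of norm at most 1 that is small on a large
    bounded set ([boundary_trace_small]).  The estimate holds for C^1 functions on Omega
    with no global Lipschitz bound, so the formula for N is valid for all of them
    ([boundary_traceE]).

    It remains to see that the functional lies in the Arens-Eells space.  If psi vanishes
    on a fine finite net of a large piece of the boundary then psi is small there, so the
    functional is at most e times the norm on the subspace of such psi; extending one
    constraint at a time, Hahn-Banach gives a combination of Dirac masses at the points
    of the net that is e-close to the functional ([finite_hahn_banach],
    [arens_eells_of_small]).  Elements of the Arens-Eells space are weak-star continuous.

    Uniqueness holds because the C^1 functions approximating psi restrict to a bounded
    sequence of Lip_b that converges pointwise to psi, hence weakly-star
    ([weak_star_cvg]), and any admissible functional is determined on these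
    restrictions. *)

(** * A C^1 step function *)

Section step.
Context {R : realType}.
Implicit Types t : R.

(** A quadratic Taylor remainder forces differentiability; for the piecewise quadratic
    functions below it replaces a discussion of one-sided derivatives. *)
Lemma is_derive_quadratic (f : R -> R) (x l C : R) :
  (forall h, `|f (x + h) - f x - l * h| <= C * h ^+ 2) -> is_derive x 1 f l.
Proof.
move=> fC.
have C0 : 0 <= C by have := le_trans (normr_ge0 _) (fC 1); rewrite expr1n mulr1.
have fl : h^-1 *: (f (h *: 1 + x) - f x) @[h --> 0^'] --> l.
  apply/cvgrPdist_le => e e0; near=> h.
  have h0 : h != 0 by near: h; exact: nbhs_dnbhs_neq.
  have -> : l - h^-1 *: (f (h *: 1 + x) - f x) =
      - (h^-1 * (f (x + h) - f x - l * h)).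
    by rewrite /GRing.scale/= mulr1 [h + x]addrC; field.
  rewrite normrN normrM normfV ler_pdivrMl ?normr_gt0//.
  apply: (le_trans (fC h)); rewrite -[h ^+ 2]ger0_norm ?sqr_ge0//.
  rewrite normrX expr2 mulrCA ler_wpM2l//.
  apply: (@le_trans _ _ ((1 + C) * `|h|)).
    by rewrite ler_wpM2r// lerDr.
  rewrite -ler_pdivlMl ?ltr_pwDl//.
  near: h; apply: dnbhs0_le; rewrite mulr_gt0// invr_gt0 ltr_pwDl//.
by split; [apply/cvg_ex; exists l | apply/cvg_lim].
Unshelve. all: by end_near.
Qed.

Definition sqpos t := Num.max t 0 ^+ 2.

(** The antiderivative of a piecewise linear hat of integral 1 on [0, 1]; it is of class
    C^1 and every cutoff and partition of unity below is built from it. *)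
Definition step t := 2 * (sqpos t - 2 * sqpos (t - 2^-1) + sqpos (t - 1)).

Definition dstep t :=
  4 * (Num.max t 0 - 2 * Num.max (t - 2^-1) 0 + Num.max (t - 1) 0).

Lemma sqpos_quadratic t h :
  `|sqpos (t + h) - sqpos t - 2 * Num.max t 0 * h| <= h ^+ 2.
Proof.
rewrite /sqpos ler_norml.
by rewrite /Num.max; case: ltP => a; case: ltP => b; apply/andP; split; nra.
Qed.

Lemma is_derive_step t : is_derive t 1 step (dstep t).
Proof.
apply: (@is_derive_quadratic _ _ _ 8) => h.
have := sqpos_quadratic t h; have := sqpos_quadratic (t - 2^-1) h.
have := sqpos_quadratic (t - 1) h.
rewrite /step /dstep ![t - _ + h]addrAC !ler_norml => /andP[? ?] /andP[? ?] /andP[? ?].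
by apply/andP; split; lra.
Qed.

Lemma step_le0 t : t <= 0 -> step t = 0.
Proof. by move=> t0; rewrite /step /sqpos !max_r; lra. Qed.

Lemma step_ge1 t : 1 <= t -> step t = 1.
Proof. by move=> t0; rewrite /step /sqpos !max_l; try lra; field. Qed.

Lemma dstep_bound t : 0 <= dstep t <= 2.
Proof.
by rewrite /dstep /Num.max; case: ltP => a; case: ltP => b; case: ltP => c;
  apply/andP; split; lra.
Qed.

Lemma dstep_eq0 t : ~~ (0 < t < 1) -> dstep t = 0.
Proof.
rewrite negb_and -!leNgt => /orP[] ?; rewrite /dstep.
  by rewrite !max_r; lra.
by rewrite !max_l; lra.
Qed.

Lemma step_bound t : 0 <= step t <= 1.
Proof.
by rewrite /step /sqpos /Num.max; case: ltP => a; case: ltP => b; case: ltP => c;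
  apply/andP; split; nra.
Qed.

Lemma step_gt0 t : 0 < t -> 0 < step t.
Proof.
move=> t0; rewrite /step /sqpos /Num.max.
by case: (ltP t 0) => a; case: (ltP (t - 2^-1) 0) => b;
  case: (ltP (t - 1) 0) => c; nra.
Qed.

Lemma continuous_dstep : continuous dstep.
Proof.
have mx c : continuous (fun t : R => Num.max (t - c) 0).
  move=> t; apply: (@continuous_max R R (fun t => t - c) (fun=> 0)).
    by apply: cvgB; [exact: cvg_id|exact: cvg_cst].
  exact: cvg_cst.
move=> t; apply: cvgM; first exact: cvg_cst.
apply: cvgD; last exact: mx.
apply: cvgB; last by apply: cvgM; [exact: cvg_cst|exact: mx].
by have := mx 0 t; rewrite /continuous_at subr0; under eq_fun do rewrite subr0.
Qed.

End step.

(** * Functions of class C^1 on R^n *)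

(** Differentiability is local because the remainder estimate only concerns points close
    to [x]. *)
Lemma near_eq_differentiable (R : numFieldType) (V W : normedModType R)
    (f g : V -> W) (x : V) :
  {near x, f =1 g} -> differentiable f x -> differentiable g x.
Proof.
move=> fg df; have [dfc /eqaddoP fo] := (diff_locallyP _ _).1 df.
have fgx := nbhs_singleton fg.
have go : g \o shift x = cst (g x) + 'd f x +o_ 0 id.
  apply/eqaddoP => e e0; have := fo e e0.
  have : \forall h \near 0, f (h + x) = g (h + x).
    by move: fg; rewrite (near_shift 0)/=; apply: filterS => h /=; rewrite subr0.
  by apply: filterS2 => h /=; rewrite !fctE/= fgx => <-.
apply/diff_locallyP; have -> : ('d g x : _ -> _) = 'd f x.
  exact: diff_unique.
by [].
Qed.

Section C1_calculus.
Context {R : realType} {n : nat}.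
Implicit Types (f g : 'rV[R]_n -> R) (x : 'rV[R]_n) (D : set 'rV[R]_n).

Lemma partialD i f g x : differentiable f x -> differentiable g x ->
  partial i (fun y => f y + g y) x = partial i f x + partial i g x.
Proof. by move=> df dg; rewrite /partial deriveD//; exact: diff_derivable. Qed.

Lemma partialM i f g x : differentiable f x -> differentiable g x ->
  partial i (fun y => f y * g y) x = f x * partial i g x + g x * partial i f x.
Proof. by move=> df dg; rewrite /partial deriveM//; exact: diff_derivable. Qed.

Lemma partial_cst i (c : R) x : partial i (fun=> c) x = 0.
Proof. exact: derive_cst. Qed.

Lemma partial_comp i (u du : R -> R) f x :
  (forall t : R, is_derive t (1 : R) u (du t)) ->
  differentiable f x -> partial i (fun y => u (f y)) x = du (f x) * partial i f x.
Proof.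
move=> udu df.
have du' : differentiable u (f x) by apply/derivable1_diffP; case: (udu (f x)).
rewrite /partial -/(u \o f) !deriveE//; last exact: differentiable_comp.
rewrite diff_comp//= -[X in 'd u _ X]mulr1 -[_ * 1]/(_ *: (1 : R)) linearZ/=.
rewrite -[X in _ *: X]deriveE//; have [_ ->] := udu (f x); exact: mulrC.
Qed.

(** Covers both coordinates and functions that do not depend on the [i]-th variable. *)
Lemma partial_affine i f x l :
  (forall h : R, f (h *: delta_mx ord0 i + x) = f x + h * l) -> partial i f x = l.
Proof.
move=> fl; apply: cvg_lim => //.
apply: (@cvg_trans _ (cst l @ (0 : R)^')); last exact: cvg_cst.
apply: near_eq_cvg; near=> h.
have h0 : h != 0 by near: h; exact: nbhs_dnbhs_neq.
by rewrite /= fl [f x + _]addrC addrK /GRing.scale/= mulKf.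
Unshelve. all: by end_near. Qed.

Lemma partial_coord i j x : partial i (fun y => y ord0 j) x = (i == j)%:R.
Proof. by apply: partial_affine => h; rewrite !mxE addrC eqxx eq_sym. Qed.

Lemma C1_continuous D f x : C1 D f -> D x -> {for x, continuous f}.
Proof. by move=> [df _] /df/differentiable_continuous. Qed.

Lemma C1_sub D D' f : D' `<=` D -> C1 D f -> C1 D' f.
Proof. by move=> D'D [df cf]; split => [x|i x] /D'D; [exact: df|exact: cf]. Qed.

Lemma near_eq_partial i f g x :
  {near x, f =1 g} -> {near x, partial i f =1 partial i g}.
Proof.
by move=> /nbhs_interior; apply: filterS => y; exact: near_eq_derive.
Qed.

Lemma near_eq_continuous f g x :
  {near x, f =1 g} -> {for x, continuous f} -> {for x, continuous g}.
Proof.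
move=> fg cf; have fgx : f x = g x := nbhs_singleton fg.
by rewrite /prop_for /continuous_at -fgx; exact: (cvg_trans (near_eq_cvg fg) cf).
Qed.

Lemma near_eq_C1 D f g : (forall x, D x -> {near x, f =1 g}) -> C1 D f -> C1 D g.
Proof.
move=> fg [df cf]; split => [x Dx|i x Dx].
  exact/(near_eq_differentiable (fg x Dx))/df.
have pfg := near_eq_partial i (fg x Dx).
exact: near_eq_continuous pfg (cf i x Dx).
Qed.

(** Lets a function defined piecewise be compared, point by point, with a C^1 one. *)
Lemma C1_local D f : (forall x, D x -> exists2 g, C1 [set x] g & {near x, f =1 g}) ->
  C1 D f.
Proof.
move=> fP; split => [x Dx|i x Dx]; have [g g1 gf] := fP _ Dx.
  have [||+ _] := @near_eq_C1 [set x] g f => //; last exact.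
  by move=> _ ->; move: gf; apply: filterS => y ->.
have [||_] := @near_eq_C1 [set x] g f => //; last exact.
by move=> _ ->; move: gf; apply: filterS => y ->.
Qed.

Lemma C1_cst D (c : R) : C1 D (fun=> c).
Proof.
split => [x _|i x _]; first exact: differentiable_cst.
have -> : partial i (fun=> c) = fun=> 0 by apply/funext => y; exact: partial_cst.
exact: cst_continuous.
Qed.

Lemma C1D D f g : open D -> C1 D f -> C1 D g -> C1 D (fun x => f x + g x).
Proof.
move=> oD [df cf] [dg cg]; split => [x Dx|i x Dx].
  by apply: differentiableD; [exact: df|exact: dg].
have e : {near x, (fun y => partial i f y + partial i g y) =1
                  partial i (fun y => f y + g y)}.
  near=> y; rewrite partialD//; [apply: df|apply: dg];
    by near: y; exact: open_nbhs_nbhs.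
apply: (near_eq_continuous e).
by apply: (continuousD (cf i x Dx) (cg i x Dx)).
Unshelve. all: by end_near. Qed.

Lemma C1M D f g : open D -> C1 D f -> C1 D g -> C1 D (fun x => f x * g x).
Proof.
move=> oD Cf Cg; have [[df cf] [dg cg]] := (Cf, Cg); split => [x Dx|i x Dx].
  by apply: differentiableM; [exact: df|exact: dg].
have e : {near x, (fun y => f y * partial i g y + g y * partial i f y) =1
                  partial i (fun y => f y * g y)}.
  near=> y; rewrite partialM//; [apply: df|apply: dg];
    by near: y; exact: open_nbhs_nbhs.
apply: (near_eq_continuous e).
apply: (continuousD (continuousM (C1_continuous Cf Dx) (cg i x Dx))).
exact: (continuousM (C1_continuous Cg Dx) (cf i x Dx)).
Unshelve. all: by end_near. Qed.

Lemma C1_comp D (u du : R -> R) f : open D ->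
  (forall t : R, is_derive t (1 : R) u (du t)) -> continuous du ->
  C1 D f -> C1 D (fun x => u (f x)).
Proof.
move=> oD udu cdu Cf; have [df cf] := Cf; split => [x Dx|i x Dx].
  apply: differentiable_comp; first exact: df.
  by apply/derivable1_diffP; case: (udu (f x)).
have e : {near x, (fun y => du (f y) * partial i f y) =1
                  partial i (fun y => u (f y))}.
  near=> y; rewrite (partial_comp _ udu)//; apply: df.
  by near: y; exact: open_nbhs_nbhs.
apply: (near_eq_continuous e).
apply: (continuousM _ (cf i x Dx)).
by apply: continuous_comp; [exact: C1_continuous Cf Dx|exact: cdu].
Unshelve. all: by end_near. Qed.

Lemma C1_coord D j : C1 D (fun x => x ord0 j).
Proof.
split => [x _|i x _]; first exact: differentiable_coord.
have -> : partial i (fun x => x ord0 j) = fun=> (i == j)%:R.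
  by apply/funext => y; exact: partial_coord.
exact: cst_continuous.
Qed.

Lemma C1Z D c f : open D -> C1 D f -> C1 D (fun x => c * f x).
Proof. by move=> oD Cf; exact: (C1M oD (C1_cst D c) Cf). Qed.

Lemma C1B D f g : open D -> C1 D f -> C1 D g -> C1 D (fun x => f x - g x).
Proof.
move=> oD Cf Cg.
have -> : (fun x => f x - g x) = fun x => f x + -1 * g x.
  by apply/funext => x; rewrite mulN1r.
exact: (C1D oD Cf (C1Z (-1) oD Cg)).
Qed.

Lemma C1_sum D (I : Type) (r : seq I) (P : pred I) (F : I -> 'rV[R]_n -> R) : open D ->
  (forall i, P i -> C1 D (F i)) -> C1 D (fun x => \sum_(i <- r | P i) F i x).
Proof.
move=> oD CF; elim: r => [|i r IH].
  by rewrite [X in C1 _ X](_ : _ = fun=> 0)//; [exact: C1_cst|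
    apply/funext => x; rewrite big_nil].
rewrite [X in C1 _ X](_ : _ = fun x => if P i
    then F i x + \sum_(i <- r | P i) F i x else \sum_(i <- r | P i) F i x);
  last by apply/funext => x; rewrite big_cons.
case Pi : (P i) => //.
exact: (C1D oD (CF _ Pi) IH).
Qed.

Lemma C1_prod D (I : Type) (r : seq I) (P : pred I) (F : I -> 'rV[R]_n -> R) : open D ->
  (forall i, P i -> C1 D (F i)) -> C1 D (fun x => \prod_(i <- r | P i) F i x).
Proof.
move=> oD CF; elim: r => [|i r IH].
  by rewrite [X in C1 _ X](_ : _ = fun=> 1)//; [exact: C1_cst|
    apply/funext => x; rewrite big_nil].
rewrite [X in C1 _ X](_ : _ = fun x => if P i
    then F i x * \prod_(i <- r | P i) F i x else \prod_(i <- r | P i) F i x);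
  last by apply/funext => x; rewrite big_cons.
case Pi : (P i) => //.
exact: (C1M oD (CF _ Pi) IH).
Qed.

Lemma partial_sum D i (I : Type) (r : seq I) (P : pred I) (F : I -> 'rV[R]_n -> R) x :
  open D -> D x -> (forall i, P i -> C1 D (F i)) ->
  partial i (fun x => \sum_(i <- r | P i) F i x) x =
  \sum_(j <- r | P j) partial i (F j) x.
Proof.
move=> oD Dx CF; elim: r => [|j r IH].
  rewrite big_nil [X in partial _ X](_ : _ = fun=> 0) ?partial_cst//.
  by apply/funext => y; rewrite big_nil.
rewrite big_cons [X in partial _ X](_ : _ = fun x => if P j
    then F j x + \sum_(i <- r | P i) F i x else \sum_(i <- r | P i) F i x).
  case Pj : (P j) => //.
  rewrite partialD ?IH//; first by have [+ _] := CF _ Pj; exact.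
  by have [dS _] := @C1_sum D I r P F oD CF; exact: dS.
by apply/funext => y; rewrite big_cons.
Qed.

End C1_calculus.

(** * Norms on R^n and smooth cutoffs *)

Section norms.
Context {R : realType} {n : nat}.
Implicit Types x y : 'rV[R]_n.

Definition sqnorm x : R := \sum_(i < n) x ord0 i ^+ 2.

(** Its triangle inequality is immediate and it is equivalent to the Euclidean norm, so
    Lipschitz estimates are carried out with it, at the price of factors [n]. *)
Definition l1norm x : R := \sum_(i < n) `|x ord0 i|.

Lemma sqnorm_ge0 x : 0 <= sqnorm x.
Proof. by apply: sumr_ge0 => i _; exact: sqr_ge0. Qed.

Lemma coord_le_sqnorm x i : x ord0 i ^+ 2 <= sqnorm x.
Proof.
by rewrite /sqnorm (bigD1 i)//= lerDl sumr_ge0// => j _; exact: sqr_ge0.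
Qed.

Lemma l1norm_ge0 x : 0 <= l1norm x.
Proof. exact: sumr_ge0. Qed.

Lemma coord_le_l1norm x i : `|x ord0 i| <= l1norm x.
Proof. by rewrite /l1norm (bigD1 i)//= lerDl sumr_ge0. Qed.

Lemma l1normN x : l1norm (- x) = l1norm x.
Proof. by apply: eq_bigr => i _; rewrite mxE normrN. Qed.

Lemma l1normB x y : l1norm (x - y) = l1norm (y - x).
Proof. by rewrite -l1normN opprB. Qed.

Lemma l1normD x y : l1norm (x + y) <= l1norm x + l1norm y.
Proof. by rewrite /l1norm -big_split/=; apply: ler_sum => i _; rewrite mxE ler_normD. Qed.

Lemma sqnorm_le_l1norm x : sqnorm x <= l1norm x ^+ 2.
Proof.
rewrite expr2 {1}/l1norm big_distrl/=; apply: ler_sum => i _.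
by rewrite -[leLHS]ger0_norm ?sqr_ge0// normrX expr2 ler_wpM2l// coord_le_l1norm.
Qed.

Lemma coord_le_norm x i : `|x ord0 i| <= `|x|.
Proof. by rewrite [leRHS]/Num.norm/= mx_normrE; apply: (le_bigmax _ _ (ord0, i)). Qed.

Lemma norm_le_sqnorm x c : 0 <= c -> sqnorm x <= c ^+ 2 -> `|x| <= c.
Proof.
move=> c0 xc; rewrite [leLHS]/Num.norm/= mx_normrE.
apply/bigmax_leP; split => [//|[i j] _] /=.
rewrite ord1; have := le_trans (coord_le_sqnorm x j) xc.
by move=> ?; rewrite ler_norml; apply/andP; split; nra.
Qed.

Lemma l1norm_le_norm x : l1norm x <= n%:R * `|x|.
Proof.
apply: le_trans (ler_sum _ (fun i _ => coord_le_norm x i)) _.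
by rewrite sumr_const card_ord mulr_natl.
Qed.

Lemma enorm_ge0 x : 0 <= enorm x.
Proof. exact: sqrtr_ge0. Qed.

Lemma enorm_le_l1norm x : enorm x <= l1norm x.
Proof.
by rewrite -[leRHS]ger0_norm ?l1norm_ge0// -sqrtr_sqr ler_sqrt ?sqr_ge0// sqnorm_le_l1norm.
Qed.

Lemma coord_le_enorm x i : `|x ord0 i| <= enorm x.
Proof. by rewrite -sqrtr_sqr ler_sqrt ?sqnorm_ge0// coord_le_sqnorm. Qed.

Lemma l1norm_le_enorm x : l1norm x <= n%:R * enorm x.
Proof.
apply: le_trans (ler_sum _ (fun i _ => coord_le_enorm x i)) _.
by rewrite sumr_const card_ord mulr_natl.
Qed.

Lemma enorm_gt0 x : x != 0 -> 0 < enorm x.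
Proof.
move=> x0; rewrite lt_neqAle enorm_ge0 andbT eq_sym; apply: contra x0 => /eqP x0.
apply/eqP/rowP => i; rewrite mxE; apply/eqP; rewrite -normr_le0.
by rewrite (le_trans (coord_le_enorm x i))// x0.
Qed.

Lemma C1_sqnorm q D : open D -> C1 D (fun x => sqnorm (x - q)).
Proof.
move=> oD; apply: C1_sum => // i _.
have -> : (fun x => (x - q) ord0 i ^+ 2) =
    (fun x => (x ord0 i - q ord0 i) * (x ord0 i - q ord0 i)).
  by apply/funext => x; rewrite !mxE expr2.
have c := C1B oD (C1_coord D i) (C1_cst D (q ord0 i)).
exact: (C1M oD c c).
Qed.

Lemma partial_sqnorm q i x :
  partial i (fun x => sqnorm (x - q)) x = 2 * (x ord0 i - q ord0 i).
Proof.
have oT := @openT 'rV[R]_n.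
have c j := C1B oT (C1_coord setT j) (C1_cst setT (q ord0 j)).
have dc j : differentiable (fun x => x ord0 j - q ord0 j) x by apply: (c j).1.
have p j : partial i (fun x => x ord0 j - q ord0 j) x = (i == j)%:R.
  by apply: partial_affine => h; rewrite !mxE eqxx eq_sym; ring.
rewrite [X in partial _ X _](_ : _ = fun x => \sum_(j < n)
   (x ord0 j - q ord0 j) * (x ord0 j - q ord0 j)).
  rewrite (@partial_sum _ _ setT)//; last by move=> j _; exact: (C1M oT (c j) (c j)).
  under eq_bigr do rewrite partialM// p.
  rewrite (bigD1 i)//= big1 ?addr0 ?eqxx; first by rewrite mulr1 mulr2n mulrDl mul1r.
  by move=> j; rewrite eq_sym => /negbTE ->; rewrite mulr0 addr0.
by apply/funext => y; apply: eq_bigr => j _; rewrite !mxE expr2.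
Qed.

Lemma compact_sqball q c : compact [set x | sqnorm (x - q) <= c].
Proof.
apply: bounded_closed_compact.
  exists (`|q| + (1 + c)); split; first by rewrite realE; case: leP => //= /ltW ->.
  move=> M qM x /= xc; apply: ltW; apply: le_lt_trans qM.
  rewrite -[x in leLHS](subrK q) addrC; apply: le_trans (ler_normD _ _) _.
  rewrite lerD2l.
  have c0 : 0 <= c by apply: le_trans xc; exact: sqnorm_ge0.
  rewrite [leLHS]/Num.norm/= mx_normrE; apply/bigmax_leP; split => [|[i j] _] /=.
    by rewrite addr_ge0.
  rewrite ord1; have := le_trans (coord_le_sqnorm (x - q) j) xc.
  by move=> ?; rewrite ler_norml; apply/andP; split; nra.
apply: (@closed_comp _ _ (fun x => sqnorm (x - q)) [set t | t <= c]); last exact: closed_le.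
by move=> x _; exact: C1_continuous (C1_sqnorm q openT) I.
Qed.

Lemma open_sqball q c : open [set x | sqnorm (x - q) < c].
Proof.
apply: (@open_comp _ _ (fun x => sqnorm (x - q)) [set t | t < c]); last exact: open_lt.
by move=> x _; exact: C1_continuous (C1_sqnorm q openT) I.
Qed.

End norms.

Section cutoff.
Context {R : realType} {n : nat}.
Implicit Types (x q : 'rV[R]_n) (r : R).

(** Equal to 1 on the ball of radius [r] about [q] and positive exactly on the concentric
    ball of radius [sqrt 2 * r]. *)
Definition cutoff q r x : R := step (2 - sqnorm (x - q) / r ^+ 2).

Lemma C1_cutoff q r D : open D -> C1 D (cutoff q r).
Proof.
move=> oD; apply: (C1_comp oD (@is_derive_step R)); first exact: continuous_dstep.
apply: C1B => //; first exact: C1_cst.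
rewrite [X in C1 _ X](_ : _ = fun x => (r ^+ 2)^-1 * sqnorm (x - q)).
  by apply: C1Z => //; exact: C1_sqnorm.
by apply/funext => x; rewrite mulrC.
Qed.

Lemma cutoff_bound q r x : 0 <= cutoff q r x <= 1.
Proof. exact: step_bound. Qed.

Lemma cutoff_eq1 q r x : 0 < r -> sqnorm (x - q) <= r ^+ 2 -> cutoff q r x = 1.
Proof.
move=> r0 xr; apply: step_ge1.
have : sqnorm (x - q) / r ^+ 2 <= 1 by rewrite ler_pdivrMr ?mul1r ?exprn_gt0.
lra.
Qed.

Lemma cutoff_eq0 q r x : 0 < r -> 2 * r ^+ 2 <= sqnorm (x - q) -> cutoff q r x = 0.
Proof.
move=> r0 xr; apply: step_le0.
have : 2 <= sqnorm (x - q) / r ^+ 2 by rewrite ler_pdivlMr ?exprn_gt0.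
lra.
Qed.

Lemma cutoff_gt0 q r x : 0 < r -> sqnorm (x - q) < 2 * r ^+ 2 -> 0 < cutoff q r x.
Proof.
move=> r0 xr; apply: step_gt0.
have : sqnorm (x - q) / r ^+ 2 < 2 by rewrite ltr_pdivrMr ?exprn_gt0.
lra.
Qed.

Lemma partial_cutoff q r i x : partial i (cutoff q r) x =
  dstep (2 - sqnorm (x - q) / r ^+ 2) *
  (- (r ^+ 2)^-1 * (2 * (x ord0 i - q ord0 i))).
Proof.
pose f x := 2 - sqnorm (x - q) / r ^+ 2.
have oT := @openT 'rV[R]_n.
have df : differentiable (fun x => sqnorm (x - q)) x by apply: (C1_sqnorm q oT).1.
have dg : differentiable (fun x => - (r ^+ 2)^-1 * sqnorm (x - q)) x.
  by apply: (C1Z _ oT (C1_sqnorm q oT)).1.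
have e : f = fun x => 2 + - (r ^+ 2)^-1 * sqnorm (x - q).
  by apply/funext => y; rewrite /f mulNr mulrC.
have dff : differentiable f x by rewrite e; apply: differentiableD.
rewrite (partial_comp i (@is_derive_step R) dff); congr (_ * _); rewrite e.
rewrite partialD// partial_cst add0r partialM// partial_cst mulr0 addr0.
by rewrite partial_sqnorm.
Qed.

Lemma partial_cutoff_eq0 q r i x : 0 < r -> 2 * r ^+ 2 <= sqnorm (x - q) ->
  partial i (cutoff q r) x = 0.
Proof.
move=> r0 xr; rewrite partial_cutoff dstep_eq0 ?mul0r// negb_and -leNgt subr_le0.
by rewrite ler_pdivlMr ?exprn_gt0// xr.
Qed.

(** The derivative of the step vanishes outside the ball of radius [sqrt 2 * r], where the
    gradient of the squared norm is at most [4 * r]. *)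
Lemma partial_cutoff_le q r i x : 0 < r -> `|partial i (cutoff q r) x| <= 8 / r.
Proof.
move=> r0; rewrite partial_cutoff.
set w := 2 - sqnorm (x - q) / r ^+ 2.
have [/andP[f0 f1]|/dstep_eq0 ->] := boolP (0 < w < 1); last first.
  by rewrite mul0r normr0 divr_ge0// ltW.
have [d0 d2] := andP (dstep_bound w).
rewrite normrM (ger0_norm d0).
have r20 : 0 < r ^+ 2 by rewrite exprn_gt0.
have xr : `|x ord0 i - q ord0 i| <= 2 * r.
  have : sqnorm (x - q) < 2 * r ^+ 2.
    by rewrite -ltr_pdivrMr//; rewrite /w in f0; lra.
  have := coord_le_sqnorm (x - q) i; rewrite !mxE => h1 h2.
  rewrite ler_norml; apply/andP; split; nra.
rewrite !normrM normrN normfV (gtr0_norm r20) (ger0_norm (ler0n _ 2)).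
have -> : 8 / r = 2 * ((r ^+ 2)^-1 * (2 * (2 * r))) by field; rewrite gt_eqF.
have ri0 : 0 <= (r ^+ 2)^-1 by rewrite invr_ge0 ltW.
apply: ler_pM => //; first by rewrite !mulr_ge0.
by apply: ler_wpM2l => //; apply: ler_wpM2l.
Qed.

End cutoff.

(** * Integrals of bounded measurable functions *)

Section bounded_measurable.
Context {d} {T : measurableType d} {R : realType}.
Implicit Types (D : set T) (f g : T -> R) (mu : {finite_measure set T -> \bar R}).

(** Boundedness is asked on [D] only: the functions at hand are controlled on Omega alone. *)
Definition bmeas D f := measurable_fun D f /\
  exists M : R, forall x, D x -> `|f x| <= M.

Lemma bmeas_cst D c : bmeas D (fun=> c).
Proof. by split; [exact: measurable_cst|exists `|c|]. Qed.

Lemma bmeasD D f g : bmeas D f -> bmeas D g -> bmeas D (fun x => f x + g x).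
Proof.
move=> [mf [M fM]] [mg [N gN]]; split; first exact: measurable_funD.
exists (M + N) => x Dx; apply: le_trans (ler_normD _ _) _.
by rewrite lerD ?fM ?gN.
Qed.

Lemma bmeasM D f g : bmeas D f -> bmeas D g -> bmeas D (fun x => f x * g x).
Proof.
move=> [mf [M fM]] [mg [N gN]]; split; first exact: measurable_funM.
by exists (M * N) => x Dx; rewrite normrM ler_pM ?fM ?gN.
Qed.

Lemma bmeasB D f g : bmeas D f -> bmeas D g -> bmeas D (fun x => f x - g x).
Proof.
move=> [mf [M fM]] [mg [N gN]]; split; first exact: measurable_funB.
exists (M + N) => x Dx; apply: le_trans (ler_normB _ _) _.
by rewrite lerD ?fM ?gN.
Qed.

Lemma bmeas_norm D f : bmeas D f -> bmeas D (fun x => `|f x|).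
Proof.
move=> [mf [M fM]]; split; last by exists M => x Dx; rewrite normr_id fM.
exact: measurableT_comp.
Qed.

Lemma bmeas_indic D (A : set T) : measurable A -> bmeas D \1_A.
Proof.
move=> mA; split; first exact: measurable_indic.
by exists 1 => x _; rewrite indicE normr_nat lern1; case: (_ \in _).
Qed.

Lemma bmeasS D D' f : measurable D -> D' `<=` D -> bmeas D f -> bmeas D' f.
Proof.
move=> mD D'D [mf [M fM]]; split; first exact: measurable_funS mf.
by exists M => x /D'D; exact: fM.
Qed.

Lemma bmeas_integrable mu D f : measurable D -> bmeas D f ->
  mu.-integrable D (EFin \o f).
Proof.
move=> mD [mf [M fM]]; apply: measurable_bounded_integrable => //.
  by rewrite ltey_eq fin_num_measure.
exists M; split; first exact: num_real.
by move=> K MK x Dx; apply: le_trans (fM x Dx) _; exact: ltW.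
Qed.

Lemma Rintegral_le mu D f g : measurable D -> bmeas D f -> bmeas D g ->
  (forall x, D x -> f x <= g x) -> \int[mu]_(x in D) f x <= \int[mu]_(x in D) g x.
Proof. by move=> mD bf bg fg; apply: le_Rintegral => //; exact: bmeas_integrable. Qed.

Lemma Rintegral_normB_trans mu D f g h : measurable D ->
  bmeas D f -> bmeas D g -> bmeas D h ->
  \int[mu]_(x in D) `|f x - h x| <=
  \int[mu]_(x in D) `|f x - g x| + \int[mu]_(x in D) `|g x - h x|.
Proof.
move=> mD bf bg bh.
have b1 := bmeas_norm (bmeasB bf bg); have b2 := bmeas_norm (bmeasB bg bh).
rewrite -RintegralD//; [|exact: bmeas_integrable..].
apply: Rintegral_le => //; [exact: bmeas_norm (bmeasB bf bh)|exact: bmeasD|].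
by move=> x _; exact: ler_distD.
Qed.

Lemma cvg_Rintegral_normB mu D (f_ : nat -> T -> R) f M : measurable D ->
  (forall k, measurable_fun D (f_ k)) ->
  (forall k x, D x -> `|f_ k x| <= M) -> bmeas D f ->
  (forall x, D x -> f_ ^~ x @ \oo --> f x) ->
  \int[mu]_(x in D) `|f_ k x - f x| @[k --> \oo] --> 0.
Proof.
move=> mD mf_ f_M bf f_f.
have bf_ k : bmeas D (f_ k) by split; [exact: mf_|exists M; exact: f_M].
have [|||||_ + _] := @dominated_convergence _ _ _ mu D mD (fun k => EFin \o f_ k)
  (EFin \o f) (cst M%:E).
- by move=> k; apply/measurable_EFinP.
- by apply/measurable_EFinP; case: bf.
- by apply: aeW => x Dx; apply: cvg_EFin; [exact: nearW|exact: f_f].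
- exact: (bmeas_integrable mu mD (bmeas_cst D M)).
- by apply: aeW => x k Dx; rewrite lee_fin f_M.
by move=> /fine_cvgP[_]; apply: cvg_trans; apply: near_eq_cvg; exact: nearW.
Qed.

End bounded_measurable.

(** * Approximation of Borel sets by test functions *)

(** Estimates how far [1 - (1 - f) * (1 - g)] is from the indicator of a union in terms
    of the distances of [f] and [g] to the two indicators. *)
Lemma dist_probU_le {R : realDomainType} (a b c d : R) :
  0 <= a <= 1 -> 0 <= b <= 1 -> 0 <= c <= 1 -> 0 <= d <= 1 ->
  `|1 - (1 - a) * (1 - b) - (1 - (1 - c) * (1 - d))| <= `|a - c| + `|b - d|.
Proof.
move=> /andP[a0 a1] /andP[b0 b1] /andP[c0 c1] /andP[d0 d1].
have -> : 1 - (1 - a) * (1 - b) - (1 - (1 - c) * (1 - d)) =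
    (1 - b) * (a - c) + (1 - c) * (b - d) by ring.
apply: le_trans (ler_normD _ _) _; rewrite !normrM.
by rewrite lerD// ler_piMl// ger0_norm ?subr_ge0// lerBlDr lerDl.
Qed.

Section borel.
Context {R : realType} {n : nat}.
Implicit Types (D : set 'rV[R]_n) (f : 'rV[R]_n -> R).

Lemma open_borel D : open D -> measurable (D : set (Borel R n)).
Proof. by move=> oD; apply: sub_sigma_algebra. Qed.

Lemma continuous_borel D f : open D -> (forall x, D x -> {for x, continuous f}) ->
  measurable_fun (D : set (Borel R n)) (f : Borel R n -> R).
Proof.
move=> oD cf; apply: (measurability _ (RGenOpens.measurableE R)).
move=> _ [_ [a [b ->] <-]]; apply: open_borel.
rewrite openE => z [Dz fz]; apply: filterI; first exact: open_nbhs_nbhs.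
have : nbhs (f z) `]a, b[%classic.
  by apply: open_nbhs_nbhs; split => //; exact: interval_open.
exact: cf.
Qed.

End borel.

Section approximation.
Context {R : realType} {n : nat} {J : finType}.
Variable mu : J -> {finite_measure set (Borel R n) -> \bar R}.
Variable Omega : set 'rV[R]_n.
Hypothesis Omega_open : open Omega.

Local Notation Om := (Omega : set (Borel R n)).

Let mOmega : measurable Om. Proof. exact: open_borel. Qed.

Definition test_fun (f : 'rV[R]_n -> R) := [/\ C1 setT f, forall x, 0 <= f x <= 1 &
  exists2 K, compact K /\ K `<=` Omega & forall x, ~ K x -> f x = 0].

(** Approximation in L^1 of finitely many measures at once, by functions that may be used
    in the definition of the divergence. *)
Definition approximable (g : Borel R n -> R) := forall e : R, 0 < e ->
  exists2 f, test_fun f & forall j, \int[mu j]_(x in Omega) `|g x - f x| <= e.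

Lemma bmeas_test_fun f : test_fun f -> bmeas Om f.
Proof.
move=> [Cf f01 _]; split.
  by apply: continuous_borel => // x _; exact: C1_continuous Cf I.
by exists 1 => x _; rewrite ger0_norm; have /andP[] := f01 x.
Qed.

Lemma test_fun0 : test_fun (fun=> 0).
Proof.
split; first exact: C1_cst.
  by move=> x; rewrite lexx ler01.
by exists set0 => //; split => //; exact: compact0.
Qed.

Lemma test_funM f g : test_fun f -> test_fun g -> test_fun (fun x => f x * (1 - g x)).
Proof.
move=> [Cf f01 [K [cK KO] fK]] [Cg g01 _]; split.
- by apply: C1M; [exact: openT|exact: Cf|apply: C1B; [exact: openT|exact: C1_cst|exact: Cg]].
- move=> x; have /andP[f0 f1] := f01 x; have /andP[g0 g1] := g01 x.
  by rewrite mulr_ge0 ?subr_ge0// mulr_ile1 ?subr_ge0// lerBlDr lerDl.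
- by exists K => // x Kx; rewrite fK ?mul0r.
Qed.

Lemma test_funU f g : test_fun f -> test_fun g ->
  test_fun (fun x => 1 - (1 - f x) * (1 - g x)).
Proof.
move=> [Cf f01 [K [cK KO] fK]] [Cg g01 [L [cL LO] gL]]; split.
- have oT := @openT 'rV[R]_n; have C := C1B oT (C1_cst setT 1).
  exact: (C _ (C1M oT (C _ Cf) (C _ Cg))).
- by move=> x; have /andP[f0 f1] := f01 x; have /andP[g0 g1] := g01 x; apply/andP; split; nra.
- exists (K `|` L); first by split; [exact: compactU|rewrite subUset].
  by move=> x /not_orP[Kx Lx]; rewrite fK// gL// subr0 mulr1 subrr.
Qed.

Lemma approximable_test f : test_fun f -> approximable f.
Proof.
move=> tf e e0; exists f => // j.
rewrite (_ : (fun x : Borel R n => `|f x - f x|) = fun=> 0); last first.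
  by apply/funext => x; rewrite subrr normr0.
by rewrite Rintegral_cst// mul0r ltW.
Qed.

(** Dominated convergence. *)
Lemma approximable_lim (g_ : nat -> Borel R n -> R) (g : Borel R n -> R) :
  (forall k, bmeas Om (g_ k)) -> (forall k x, Omega x -> `|g_ k x| <= 1) ->
  bmeas Om g -> (forall x, Omega x -> g_ ^~ x @ \oo --> g x) ->
  (forall k, approximable (g_ k)) -> approximable g.
Proof.
move=> bg_ g_1 bg g_g Ag_ e e0.
have : \forall k \near \oo, forall j, \int[mu j]_(x in Omega) `|g_ k x - g x| < e / 2.
  apply: filter_forall => j.
  have := @cvg_Rintegral_normB _ _ _ (mu j) Om g_ g 1 mOmega (fun k => (bg_ k).1) g_1 bg g_g.
  by move=> /cvgr_lt/(_ (e / 2)); apply; rewrite divr_gt0.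
case=> k _ /(_ k (leqnn k)) ke.
have e20 : 0 < e / 2 by rewrite divr_gt0.
have [f tf fe] := Ag_ k _ e20.
exists f => // j; have bf := bmeas_test_fun tf.
apply: le_trans (Rintegral_normB_trans _ mOmega bg (bg_ k) bf) _.
rewrite (splitr e) lerD ?fe// ltW//; apply: le_lt_trans (ke j).
by rewrite le_eqVlt; apply/orP; left; apply/eqP/eq_Rintegral => x _; rewrite distrC.
Qed.

Lemma approximable_setU (A B : set (Borel R n)) : measurable A -> measurable B ->
  approximable \1_A -> approximable \1_B -> approximable \1_(A `|` B).
Proof.
move=> mA mB aA aB e e0.
have e20 : 0 < e / 2 by rewrite divr_gt0.
have [f tf fe] := aA _ e20; have [g tg ge] := aB _ e20.
exists (fun x => 1 - (1 - f x) * (1 - g x)); first exact: test_funU.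
have [bf bg] := (bmeas_test_fun tf, bmeas_test_fun tg).
have bA := bmeas_indic (R := R) Om mA.
have bB := bmeas_indic (R := R) Om mB.
have bAf := bmeas_norm (bmeasB bA bf); have bBg := bmeas_norm (bmeasB bB bg).
move=> j; rewrite (splitr e); apply: le_trans (lerD (fe j) (ge j)).
rewrite -RintegralD//; [|exact: bmeas_integrable..].
apply: Rintegral_le => //.
- apply/bmeas_norm/bmeasB; first exact/bmeas_indic/measurableU.
  exact/bmeas_test_fun/test_funU.
- exact: bmeasD.
move=> x _; have [_ /(_ x)/andP[f0 f1] _] := tf; have [_ /(_ x)/andP[g0 g1] _] := tg.
have -> : \1_(A `|` B) x = 1 - (1 - \1_A x) * (1 - \1_B x) :> R.
  by rewrite !indicE in_setU; case: (_ \in A); case: (_ \in B) => /=; ring.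
apply: dist_probU_le => //; rewrite ?f0 ?g0// indicE; case: (_ \in _) => /=;
  by rewrite ?lexx ?ler01.
Qed.

(** The indicators of the finite partial unions converge pointwise. *)
Lemma approximable_bigcup (A : (set (Borel R n))^nat) : (forall k, measurable (A k)) ->
  (forall k, approximable \1_(A k)) -> approximable \1_(\bigcup_k A k).
Proof.
move=> mA aA.
have m_ k : measurable (\bigcup_(i < k) A i) by exact: bigcup_measurable.
have mU : measurable (\bigcup_k A k) by exact: bigcup_measurable.
apply: (@approximable_lim (fun k => \1_(\bigcup_(i < k) A i))).
- by move=> k; exact: bmeas_indic.
- by move=> k x _; rewrite indicE; case: (_ \in _); rewrite ?normr1 ?normr0.
- exact: bmeas_indic.
- move=> x _; apply: cvg_near_cst.
  have [[i _ Aix]|nAx] := pselect ((\bigcup_k A k) x).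
    near=> k.
    have kA : (\bigcup_(i < k) A i) x by exists i => //=; near: k; exists i.+1.
    by rewrite !indicE !mem_set//; exists i.
  near=> k; rewrite !indicE !memNset//.
  by move=> [i /= _ Aix]; apply: nAx; exists i.
- elim=> [|k IH].
    rewrite (_ : \bigcup_(i < 0) A i = set0); last by rewrite -subset0 => x [i].
    by rewrite indic0; exact: approximable_test test_fun0.
  have -> : \bigcup_(i < k.+1) A i = (\bigcup_(i < k) A i) `|` A k.
    by rewrite !bigcup_mkord big_ord_recr.
  exact: approximable_setU.
Unshelve. all: by end_near. Qed.

Lemma approximable_eq (g h : Borel R n -> R) : (forall x, Omega x -> g x = h x) ->
  approximable g -> approximable h.
Proof.
move=> gh ag e e0; have [f tf fe] := ag _ e0; exists f => // j.
rewrite (le_trans _ (fe j))// le_eqVlt; apply/orP; left; apply/eqP/eq_Rintegral.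
by move=> x /[!inE] Ox; rewrite gh.
Qed.

(** With [b] a cutoff that is positive exactly on the ball, [1 - (1 - b) ^+ k] increases
    to the indicator of the ball. *)
Lemma approximable_ball q (r : R) : 0 < r ->
  [set x | sqnorm (x - q) <= 2 * r ^+ 2] `<=` Omega ->
  approximable \1_[set x | sqnorm (x - q) < 2 * r ^+ 2].
Proof.
move=> r0 qrO.
have tb : test_fun (cutoff q r).
  split; [by apply: C1_cutoff; exact: openT|exact: cutoff_bound|].
  exists [set x | sqnorm (x - q) <= 2 * r ^+ 2].
    by split => //; exact: compact_sqball.
  by move=> x /= /negP; rewrite -ltNge => /ltW/cutoff_eq0 ->.
pose g_ k x : R := 1 - (1 - cutoff q r x) ^+ k.
have tg k : test_fun (g_ k).
  elim: k => [|k IH].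
    rewrite (_ : g_ 0 = fun=> 0); first exact: test_fun0.
    by apply/funext => x; rewrite /g_ expr0 subrr.
  rewrite (_ : g_ k.+1 = fun x => 1 - (1 - cutoff q r x) * (1 - g_ k x)).
    exact: test_funU.
  by apply/funext => x; rewrite /g_ subKr exprS.
have mB : measurable ([set x | sqnorm (x - q) < 2 * r ^+ 2] : set (Borel R n)).
  by apply: open_borel; exact: open_sqball.
apply: (@approximable_lim g_).
- by move=> k; exact: bmeas_test_fun.
- by move=> k x _; have [_ /(_ x)/andP[g0 g1] _] := tg k; rewrite ger0_norm.
- exact: bmeas_indic.
- move=> x _; rewrite indicE.
  have [xB|xB] := ltP (sqnorm (x - q)) (2 * r ^+ 2).
    rewrite mem_set//= -[X in _ --> X]subr0; apply: cvgB; first exact: cvg_cst.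
    apply: cvg_expr; have := cutoff_gt0 r0 xB; have /andP[b0 b1] := cutoff_bound q r x.
    by move=> b; rewrite ger0_norm ?subr_ge0// ltrBlDr ltrDl.
  rewrite memNset/=; last by apply/negP; rewrite -leNgt.
  rewrite /g_ cutoff_eq0// subr0; under eq_fun do rewrite expr1n subrr.
  exact: cvg_cst.
- by move=> k; exact: approximable_test.
Qed.

(** An open set is the union of the rational balls whose closure it contains. *)
Lemma approximable_open U : open U -> U `<=` Omega -> approximable \1_U.
Proof.
move=> oU UO.
pose rad m : R := m.+1%:R^-1.
pose ctr (q : 'rV[rat]_n) : 'rV[R]_n := \row_i ratr (q ord0 i).
pose cball q m := [set x | sqnorm (x - ctr q) <= 2 * rad m ^+ 2].
pose A k : set 'rV[R]_n := if unpickle k is Some (q, m)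
  then if `[< cball q m `<=` U >] then [set x | sqnorm (x - ctr q) < 2 * rad m ^+ 2]
    else set0
  else set0.
have rad_gt0 m : 0 < rad m by rewrite invr_gt0.
have AP k : measurable (A k : set (Borel R n)) /\ approximable \1_(A k).
  rewrite /A; case: unpickle => [[q m]|]; last first.
    by split => //; rewrite indic0; exact: approximable_test test_fun0.
  case: asboolP => [qU|_]; last first.
    by split => //; rewrite indic0; exact: approximable_test test_fun0.
  split; last by apply: approximable_ball => // x /qU/UO.
  by apply: open_borel; exact: open_sqball.
have -> : U = \bigcup_k A k.
  apply/seteqP; split => [x Ux|x [k _]]; last first.
    rewrite /A; case: unpickle => [[q m]|//]; case: asboolP => // qU /= xq.
    by apply: qU; exact: ltW.
  have /nbhs_ballP[e /= e0 eU] : nbhs x U by apply: open_nbhs_nbhs.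
  have [m me] : exists m, 3 * rad m < e.
    have [m] := ltr_add_invr (divr_gt0 e0 (ltr0n R 3)).
    by rewrite add0r ltr_pdivlMr// mulrC => me; exists m.
  have /choice[q qP] : forall i, exists q : rat, `|x ord0 i - ratr q| <= rad m / n.+1%:R.
    move=> i; have xi : x ord0 i < x ord0 i + rad m / n.+1%:R.
      by rewrite ltrDl divr_gt0.
    have [q] := rat_in_itvoo xi; rewrite in_itv/= => /andP[q1 q2].
    exists q; rewrite distrC ler_norml lerBlDl (ltW q2) andbT.
    by rewrite lerBrDl (le_trans _ (ltW q1))// gerDl oppr_le0 divr_ge0 ?ltW.
  have xq : sqnorm (x - ctr (\row_i q i)) <= rad m ^+ 2.
    have xr : l1norm (x - ctr (\row_i q i)) <= rad m.
      apply: (@le_trans _ _ (\sum_(i < n) rad m / n.+1%:R)).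
        by apply: ler_sum => i _; rewrite !mxE.
      rewrite sumr_const card_ord -[X in X <= _]mulr_natr -mulrA ler_piMr ?ltW//.
      by rewrite mulrC ltr_pdivrMr// mul1r ltr_nat.
    apply: le_trans (sqnorm_le_l1norm _) _.
    by apply: lerXn2r => //; rewrite nnegrE ?l1norm_ge0 ?ltW.
  have qU : cball (\row_i q i) m `<=` U.
    move=> y yq; apply: eU; rewrite -ball_normE/=; apply: le_lt_trans me.
    have rm := ltW (rad_gt0 m).
    have -> : x - y = (x - ctr (\row_i q i)) - (y - ctr (\row_i q i)).
      by rewrite opprB addrA subrK.
    apply: le_trans (ler_normB _ _) _.
    have -> : 3 * rad m = rad m + 2 * rad m by ring.
    apply: lerD; first exact: norm_le_sqnorm.
    apply: norm_le_sqnorm; first by rewrite mulr_ge0.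
    by apply: le_trans yq _; rewrite exprMn ler_wpM2r ?exprn_ge0// expr2; lra.
  exists (pickle (\row_i q i, m)) => //; rewrite /A pickleK.
  case: asboolP => //= _; apply: le_lt_trans xq _.
  by rewrite mulr_natl mulr2n ltrDl exprn_gt0.
by apply: approximable_bigcup => k; have [] := AP k.
Qed.

(** The sets with approximable indicator form a sigma-algebra containing the open sets.
    For complements, Omega itself is open, hence approximable by some [g], and
    [g * (1 - f)] approximates the complement of what [f] approximates. *)
Lemma approximable_borel (A : set (Borel R n)) : measurable A -> approximable \1_A.
Proof.
move: A; suff sa : sigma_algebra setT
    [set A : set (Borel R n) | measurable A /\ approximable \1_A].
  move=> A mA; suff [] : [set A : set (Borel R n) | measurable A /\ approximable \1_A] A.
    by [].
  apply: (smallest_sub sa) mA => U oU /=; split; first exact: open_borel.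
  apply: (@approximable_eq \1_(U `&` Omega)); last first.
    by apply: approximable_open; [exact: openI|exact: subIsetr].
  by move=> x Ox; rewrite !indicE in_setI (mem_set Ox) andbT.
split.
- by split => //; rewrite indic0; exact: approximable_test test_fun0.
- move=> A [mA aA]; split; first exact: measurableD.
  move=> e e0; have e20 : 0 < e / 2 by rewrite divr_gt0.
  have [f tf fe] := aA _ e20.
  have [g tg ge] := approximable_open Omega_open (@subset_refl _ Omega) e20.
  exists (fun x => g x * (1 - f x)); first exact: test_funM.
  have [bf bg] := (bmeas_test_fun tf, bmeas_test_fun tg).
  have bA := bmeas_indic (R := R) Om mA.
  have bO := bmeas_indic (R := R) Om mOmega.
  have bAf := bmeas_norm (bmeasB bA bf); have bOg := bmeas_norm (bmeasB bO bg).
  move=> j; rewrite (splitr e); apply: le_trans (lerD (ge j) (fe j)).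
  rewrite -RintegralD//; [|exact: bmeas_integrable..].
  apply: Rintegral_le => //.
  + apply/bmeas_norm/bmeasB; first exact/bmeas_indic/measurableD.
    exact/bmeas_test_fun/test_funM.
  + exact: bmeasD.
  move=> x Ox; have [_ /(_ x)/andP[f0 f1] _] := tf; have [_ /(_ x)/andP[g0 g1] _] := tg.
  have -> : \1_(setT `\` A) x - g x * (1 - f x) =
      (\1_Omega x - g x) * (1 - f x) - (\1_A x - f x) :> R.
    rewrite !indicE in_setD (mem_set (I : setT x)) (mem_set Ox).
    by case: (_ \in A) => /=; ring.
  apply: le_trans (ler_normB _ _) _; rewrite lerD2r normrM ler_piMr//.
  by rewrite ger0_norm ?subr_ge0// lerBlDr lerDl.
- move=> A AP; split; first by apply: bigcup_measurable => k _; have [] := AP k.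
  by apply: approximable_bigcup => k; have [] := AP k.
Qed.

End approximation.

(** * Integrals against signed measures *)

Section charge_integral.
Context {R : realType} {n : nat}.
Implicit Types (nu : signed_measure R n) (D : set (Borel R n)) (f g : Borel R n -> R).

(** A boolean index makes the positive and negative parts one family of measures, to
    which the approximation of Borel sets applies simultaneously. *)
Definition jordan_part nu (b : bool) : {finite_measure set (Borel R n) -> \bar R} :=
  if b then jordan_pos (hahnP nu) : {finite_measure set (Borel R n) -> \bar R}
  else jordan_neg (hahnP nu) : {finite_measure set (Borel R n) -> \bar R}.

Lemma eq_charge_integral nu D f g : (forall x, D x -> f x = g x) ->
  charge_integral nu D f = charge_integral nu D g.
Proof.
by move=> fg; rewrite /charge_integral; congr (_ - _); apply: eq_Rintegral => x;
  rewrite inE => /fg.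
Qed.

Lemma charge_integralD nu D f g : measurable D -> bmeas D f -> bmeas D g ->
  charge_integral nu D (fun x => f x + g x) =
  charge_integral nu D f + charge_integral nu D g.
Proof.
move=> mD bf bg; rewrite /charge_integral.
by rewrite !RintegralD//; [rewrite opprD addrACA|exact: bmeas_integrable..].
Qed.

Lemma charge_integralZ nu D (a : R) f : measurable D -> bmeas D f ->
  charge_integral nu D (fun x => a * f x) = a * charge_integral nu D f.
Proof.
move=> mD bf; rewrite /charge_integral.
by rewrite !RintegralZl//; [rewrite mulrBr|exact: bmeas_integrable..].
Qed.

Lemma charge_integral_indic nu D A f : A `<=` D ->
  charge_integral nu A f = charge_integral nu D (fun x => \1_A x * f x).
Proof.
move=> AD; rewrite -(setIidr AD) /charge_integral !Rintegral_mkcondr.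
by congr (_ - _); apply: eq_Rintegral => x _; rewrite patchE indicE (setIidr AD);
  case: (x \in A); rewrite ?mul1r ?mul0r.
Qed.

Lemma charge_integral_split nu D A f g : measurable D -> measurable A -> A `<=` D ->
  bmeas D f -> bmeas D g -> charge_integral nu A g =
  charge_integral nu D (fun x => (\1_A x - f x) * g x) +
  charge_integral nu D (fun x => f x * g x).
Proof.
move=> mD mA AD bf bg; rewrite (charge_integral_indic _ _ AD).
have bA := bmeas_indic (R := R) D mA.
rewrite -charge_integralD//; [|by apply: bmeasM => //; exact: bmeasB|exact: bmeasM].
by apply: eq_charge_integral => x _; rewrite mulrBl subrK.
Qed.

Lemma charge_integral_le nu D f g : measurable D -> bmeas D f -> bmeas D g ->
  (forall x, D x -> `|f x| <= g x) ->
  `|charge_integral nu D f| <= \sum_b \int[jordan_part nu b]_(x in D) g x.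
Proof.
move=> mD bf bg fg; rewrite big_bool; apply: le_trans (ler_normB _ _) _.
have b1 := bmeas_norm bf.
by apply: lerD; apply: le_trans (le_normr_Rintegral mD _) _ => //;
  [exact: bmeas_integrable|exact: Rintegral_le|exact: bmeas_integrable|exact: Rintegral_le].
Qed.

End charge_integral.

Section test_functions.
Context {R : realType} {n : nat}.
Variable Omega : set 'rV[R]_n.

Lemma test_fun_near0 (f : 'rV[R]_n -> R) (K : set 'rV[R]_n) x :
  compact K -> (forall y, ~ K y -> f y = 0) -> ~ K x ->
  {near x, f =1 fun=> 0}.
Proof.
move=> cK fK Kx; have oK : open (~` K).
  by apply: closed_openC; apply: compact_closed cK; exact: norm_hausdorff.
by move: (open_nbhs_nbhs (conj oK Kx)); apply: filterS => y; exact: fK.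
Qed.

(** The radius is kept at least 1 so that gradients of cutoffs at that scale are bounded
    by an absolute constant. *)
Lemma test_fun_support_bounded f : test_fun Omega f ->
  exists2 r : R, 1 <= r & forall x, r ^+ 2 < sqnorm x -> {near x, f =1 fun=> 0}.
Proof.
move=> [_ _ [K [cK _] fK]]; have [M [_ KM]] := compact_bounded cK.
pose m := `|M| + 1.
have Mm : M < m by rewrite (le_lt_trans (ler_norm M))// ltrDl.
exists (1 + n%:R * m) => [|x rx]; first by rewrite lerDl mulr_ge0 ?addr_ge0.
apply: (test_fun_near0 cK fK) => Kx; move: rx; apply/negP; rewrite -leNgt.
apply: le_trans (sqnorm_le_l1norm _) _; apply: lerXn2r.
- by rewrite nnegrE l1norm_ge0.
- by rewrite nnegrE addr_ge0 ?mulr_ge0 ?addr_ge0.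
apply: le_trans (l1norm_le_norm _) _; apply: (@le_trans _ _ (n%:R * m)).
  by rewrite ler_wpM2l//; exact: KM.
by rewrite lerDr.
Qed.

Lemma test_fun_partial_bounded f : test_fun Omega f ->
  exists2 C : R, 0 <= C & forall i x, `|partial i f x| <= C.
Proof.
move=> [[_ cf] _ [K [cK _] fK]].
have /choice[C CP] : forall i : 'I_n, exists C : R, forall x, `|partial i f x| <= C.
  move=> i; have cKf : compact (partial i f @` K).
    apply: continuous_compact => //; apply: continuous_subspaceT => x; exact: cf.
  have [M [_ KM]] := compact_bounded cKf.
  exists (`|M| + 1) => x; have [Kx|Kx] := pselect (K x).
    by apply: KM; [rewrite (le_lt_trans (ler_norm M))// ltrDl|exists x].
  rewrite (_ : partial i f x = 0) ?normr0 ?addr_ge0//.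
  have := nbhs_singleton (near_eq_partial i (test_fun_near0 cK fK Kx)).
  by rewrite /= partial_cst.
exists (\sum_i `|C i|) => [|i x]; first exact: sumr_ge0.
by rewrite (le_trans (CP i x))// (le_trans (ler_norm _))// (bigD1 i)//= lerDl sumr_ge0.
Qed.

End test_functions.

(** * The normal trace of C^1 functions *)

Section normal_trace.
Context {R : realType} {n : nat}.
Variables (Omega : set 'rV[R]_n) (F : 'I_n -> signed_measure R n)
  (nu : signed_measure R n) (E : set (Borel R n)).
Hypotheses (Omega_open : open Omega) (F_nu : is_divergence Omega F nu).
Hypotheses (mE : measurable E) (E_sub : E `<=` Omega).

Local Notation Om := (Omega : set (Borel R n)).

Let mOmega : measurable Om. Proof. exact: open_borel. Qed.

(** The right-hand side of the formula that characterises the normal trace. *)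
Definition normal_trace (phi : 'rV[R]_n -> R) : R :=
  - grad_integral F E phi - charge_integral nu E phi.

Definition C1_le (K : R) (phi : 'rV[R]_n -> R) := [/\ C1 Omega phi,
  forall x, Omega x -> `|phi x| <= K &
  forall i x, Omega x -> `|partial i phi x| <= K].

Lemma C1b_C1_le phi : C1b Omega phi -> exists2 K, 0 <= K & C1_le K phi.
Proof.
move=> [C [M phiM] /choice[N phiN]].
have N0 : 0 <= \sum_i `|N i| by exact: sumr_ge0.
exists (`|M| + \sum_i `|N i|); first by rewrite addr_ge0.
split => // [x Ox|i x Ox].
  by rewrite (le_trans (phiM x Ox))// (le_trans (ler_norm _))// lerDl.
rewrite (le_trans (phiN i x Ox))// (le_trans (ler_norm _))//.
by rewrite (bigD1 i)//= addrCA lerDl addr_ge0// sumr_ge0.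
Qed.

Lemma C1_le_bmeas K phi : C1_le K phi ->
  bmeas Om phi /\ forall i, bmeas Om (partial i phi).
Proof.
move=> [C phiK dphiK]; split => [|i]; split.
- by apply: continuous_borel => // x Ox; exact: C1_continuous C Ox.
- by exists K.
- by apply: continuous_borel => // x Ox; exact: C.2.
- by exists K; exact: dphiK.
Qed.

Lemma C1_leD K L phi psi : C1_le K phi -> C1_le L psi ->
  C1_le (K + L) (fun x => phi x + psi x).
Proof.
move=> [C1 K1 dK1] [C2 K2 dK2]; split => [|x Ox|i x Ox]; first exact: C1D.
  exact: le_trans (ler_normD _ _) (lerD (K1 x Ox) (K2 x Ox)).
rewrite partialD; [|exact: C1.1|exact: C2.1].
exact: le_trans (ler_normD _ _) (lerD (dK1 i x Ox) (dK2 i x Ox)).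
Qed.

Lemma C1_leZ K a phi : C1_le K phi -> C1_le (`|a| * K) (fun x => a * phi x).
Proof.
move=> [C1 K1 dK1]; split => [|x Ox|i x Ox]; first exact: C1Z.
  by rewrite normrM ler_wpM2l// K1.
rewrite partialM; [|exact: differentiable_cst|exact: C1.1].
by rewrite partial_cst mulr0 addr0 normrM ler_wpM2l// dK1.
Qed.

Lemma C1_leB K L phi psi : C1_le K phi -> C1_le L psi ->
  C1_le (K + L) (fun x => phi x - psi x).
Proof.
move=> c1 c2; have := C1_leD c1 (C1_leZ (-1) c2).
rewrite normrN1 mul1r (_ : (fun x => phi x + -1 * psi x) = fun x => phi x - psi x)//.
by apply/funext => x; rewrite mulN1r.
Qed.

Lemma normal_traceD K L phi psi : C1_le K phi -> C1_le L psi ->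
  normal_trace (fun x => phi x + psi x) = normal_trace phi + normal_trace psi.
Proof.
move=> c1 c2; have [b1 db1] := C1_le_bmeas c1; have [b2 db2] := C1_le_bmeas c2.
have bE f : bmeas Om f -> bmeas E f by exact: bmeasS.
rewrite /normal_trace charge_integralD//; [|exact: bE..].
rewrite (_ : grad_integral F E _ = grad_integral F E phi + grad_integral F E psi).
  by rewrite !opprD addrACA.
rewrite /grad_integral -big_split; apply: eq_bigr => i _ /=.
rewrite -charge_integralD//; [|exact: bE..].
apply: eq_charge_integral => x /E_sub Ox.
by apply: partialD; [case: c1 => -[+ _] _ _|case: c2 => -[+ _] _ _]; exact.
Qed.

Lemma normal_traceZ K a phi : C1_le K phi ->
  normal_trace (fun x => a * phi x) = a * normal_trace phi.
Proof.
move=> c1; have [b1 db1] := C1_le_bmeas c1.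
have bE f : bmeas Om f -> bmeas E f by exact: bmeasS.
rewrite /normal_trace charge_integralZ//; last exact: bE.
rewrite (_ : grad_integral F E _ = a * grad_integral F E phi).
  by ring.
rewrite /grad_integral mulr_sumr; apply: eq_bigr => i _ /=.
rewrite -charge_integralZ//; last exact: bE.
apply: eq_charge_integral => x /E_sub Ox.
rewrite partialM; [|exact: differentiable_cst|by case: c1 => -[+ _] _ _; exact].
by rewrite partial_cst mulr0 addr0.
Qed.

Lemma normal_traceB K L phi psi : C1_le K phi -> C1_le L psi ->
  normal_trace (fun x => phi x - psi x) = normal_trace phi - normal_trace psi.
Proof.
move=> c1 c2; have := normal_traceD c1 (C1_leZ (-1) c2).
rewrite (normal_traceZ _ c2) mulN1r => <-; congr normal_trace.
by apply/funext => x; rewrite mulN1r.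
Qed.

(** All positive and negative parts of the components of F and of its divergence. *)
Definition jordan_parts (j : option 'I_n * bool) :
    {finite_measure set (Borel R n) -> \bar R} :=
  jordan_part (if j.1 is Some i then F i else nu) j.2.

Lemma normal_trace_bounded : exists2 C, 0 <= C &
  forall K phi, 0 <= K -> C1_le K phi -> `|normal_trace phi| <= C * K.
Proof.
pose m (mu : signed_measure R n) := \sum_b fine (jordan_part mu b E).
have m0 mu : 0 <= m mu by apply: sumr_ge0 => b _; exact: fine_ge0.
have mP mu K f : bmeas E f -> (forall x, E x -> `|f x| <= K) ->
    `|charge_integral mu E f| <= m mu * K.
  move=> bf fK; apply: le_trans (charge_integral_le mu mE bf (bmeas_cst E K) fK) _.
  rewrite /m mulr_suml le_eqVlt; apply/orP; left; apply/eqP.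
  by apply: eq_bigr => b _; rewrite Rintegral_cst// mulrC.
exists (\sum_i m (F i) + m nu); first by rewrite addr_ge0// sumr_ge0.
move=> K phi K0 c; have [b db] := C1_le_bmeas c; have [_ phiK dphiK] := c.
have bE f : bmeas Om f -> bmeas E f by exact: bmeasS.
apply: le_trans (ler_normB _ _) _; rewrite normrN mulrDl; apply: lerD; last first.
  by apply: mP; [exact: bE|move=> x /E_sub; exact: phiK].
rewrite mulr_suml; apply: le_trans (ler_norm_sum _ _ _) _; apply: ler_sum => i _.
by apply: mP; [exact: bE|move=> x /E_sub; exact: dphiK].
Qed.

Lemma compact_support_C1c f phi : test_fun Omega f -> C1 Omega phi ->
  C1c Omega (fun x => f x * phi x).
Proof.
move=> [Cf _ [K [cK KO] fK]] Cphi.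
have sK : closure [set x | Omega x /\ f x * phi x != 0] `<=` K.
  have /closure_id -> := compact_closed (@norm_hausdorff _ _) cK.
  apply: closure_subset => x [_]; apply: contraNP => Kx.
  by rewrite fK ?mul0r.
split; first exact: (C1M Omega_open (C1_sub (@subsetT _ _) Cf) Cphi).
- apply: subclosed_compact cK sK; exact: closed_closure.
- exact: subset_trans sK KO.
Qed.

(** The definition of the divergence, tested with [f * phi].  In the last sum no derivative
    falls on [phi]; the first two terms are small when [f] is close to the indicator of [E]. *)
Lemma normal_trace_split f K phi : test_fun Omega f -> C1_le K phi ->
  normal_trace phi =
  - (\sum_i charge_integral (F i) Om (fun x => (\1_E x - f x) * partial i phi x))
  - charge_integral nu Om (fun x => (\1_E x - f x) * phi x)
  + \sum_i charge_integral (F i) Om (fun x => phi x * partial i f x).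
Proof.
move=> tf c; have [b db] := C1_le_bmeas c; have [Cphi phiK dphiK] := c.
have [Cf f01 _] := tf; have bf := bmeas_test_fun Omega_open tf.
have bE := bmeas_indic (R := R) Om mE.
have [C C0 dfC] := test_fun_partial_bounded tf.
have bdf i : bmeas Om (partial i f).
  by split; [apply: continuous_borel => // x _; exact: Cf.2|exists C].
have := F_nu.2 _ (compact_support_C1c tf Cphi).
have -> : grad_integral F Omega (fun x => f x * phi x) =
    \sum_i charge_integral (F i) Om (fun x => f x * partial i phi x) +
    \sum_i charge_integral (F i) Om (fun x => phi x * partial i f x).
  rewrite -big_split/=; apply: eq_bigr => i _.
  rewrite -charge_integralD//; [|exact: bmeasM..].
  apply: eq_charge_integral => x Ox; apply: partialM; first exact: Cf.1.
  exact: Cphi.1.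
have gE : grad_integral F E phi =
    \sum_i charge_integral (F i) Om (fun x => (\1_E x - f x) * partial i phi x) +
    \sum_i charge_integral (F i) Om (fun x => f x * partial i phi x).
  rewrite -big_split/=; apply: eq_bigr => i _.
  exact: charge_integral_split mOmega mE E_sub bf (db i).
rewrite /normal_trace gE (charge_integral_split nu mOmega mE E_sub bf b).
have alg (x1 x2 x3 y1 y2 : R) : x2 + x3 = - y2 ->
    - (x1 + x2) - (y1 + y2) = - x1 - y1 + x3 by move=> h; lra.
exact: alg.
Qed.

(** Choose [f] in [normal_trace_split] with L^1 error proportional to [e / (K + 1)]; the
    remaining sum is at most the sup of [phi] on a ball containing the support of [f], times
    a constant that depends on [f] only. *)
Lemma normal_trace_continuous (K e : R) : 0 <= K -> 0 < e ->
  exists r d : R, [/\ 1 <= r, 0 < d & forall phi, C1_le K phi ->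
    (forall x, Omega x -> sqnorm x <= r ^+ 2 -> `|phi x| <= d) ->
    `|normal_trace phi| <= e].
Proof.
move=> K0 e0.
have N0 : 0 < 4 * n.+1%:R * (K + 1) by rewrite !mulr_gt0// ltr_wpDl.
pose e1 := e / (4 * n.+1%:R * (K + 1)).
have e10 : 0 < e1 by rewrite divr_gt0.
have [f tf fe] := approximable_borel jordan_parts Omega_open mE e10.
have [r r1 fr] := test_fun_support_bounded tf.
have [C C0 dfC] := test_fun_partial_bounded tf.
pose W := \sum_i \sum_b fine (jordan_part (F i) b Om).
have W0 : 0 <= W by apply: sumr_ge0 => i _; apply: sumr_ge0 => b _; exact: fine_ge0.
have CW0 : 0 < 2 * (C * W + 1) by rewrite mulr_gt0// ltr_wpDl// mulr_ge0.
pose d := e / (2 * (C * W + 1)).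
have d0 : 0 < d by rewrite divr_gt0.
exists r, d; split => // phi c phid.
have [b db] := C1_le_bmeas c; have [Cphi phiK dphiK] := c.
have [Cf f01 _] := tf; have bf := bmeas_test_fun Omega_open tf.
have bE := bmeas_indic (R := R) Om mE.
have bEf := bmeasB bE bf.
have bKEf : bmeas Om (fun x => K * `|\1_E x - f x|).
  by apply: bmeasM; [exact: bmeas_cst|exact: bmeas_norm].
have bdf i : bmeas Om (partial i f).
  by split; [apply: continuous_borel => // x _; exact: Cf.2|exists C].
have err o (g : Borel R n -> R) : bmeas Om g -> (forall x, Omega x -> `|g x| <= K) ->
    `|charge_integral (if o is Some i then F i else nu) Om
        (fun x => (\1_E x - f x) * g x)| <= 2 * (K * e1).
  move=> bg gK; apply: le_trans (charge_integral_le _ mOmega (bmeasM bEf bg) bKEf _) _.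
    by move=> x Ox; rewrite normrM mulrC ler_wpM2r// gK.
  have -> : 2 * (K * e1) = \sum_(b : bool) K * e1 by rewrite big_bool/=; ring.
  apply: ler_sum => b' _; rewrite RintegralZl//; last first.
    exact/bmeas_integrable/bmeas_norm.
  by rewrite ler_wpM2l//; exact: (fe (o, b')).
rewrite (normal_trace_split tf c) (splitr e).
apply: le_trans (ler_normD _ _) _; apply: lerD.
  apply: le_trans (ler_normB _ _) _; rewrite normrN.
  apply: (@le_trans _ _ (\sum_(i < n) 2 * (K * e1) + 2 * (K * e1))).
    apply: lerD; last by apply: (err None).
    apply: le_trans (ler_norm_sum _ _ _) _; apply: ler_sum => i _.
    by apply: (err (Some i)) => // x; exact: dphiK.
  rewrite sumr_const card_ord -[X in X <= _]mulrSr -[X in X <= _]mulr_natr.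
  have -> : 2 * (K * e1) * n.+1%:R = (e / 2) * (K / (K + 1)).
    rewrite /e1; move: (n.+1%:R : R) (ltr0Sn R n) => N Np.
    by field; rewrite !gt_eqF// ltr_wpDl.
  rewrite ler_piMr ?divr_ge0 ?ltW// ltr_pdivrMr ?mul1r ?ltrDl//.
  by rewrite ltr_wpDl.
apply: le_trans (ler_norm_sum _ _ _) _.
apply: (@le_trans _ _ (d * (C * W))).
  rewrite /W !mulr_sumr; apply: ler_sum => i _.
  apply: le_trans (charge_integral_le _ mOmega (bmeasM b (bdf i)) (bmeas_cst _ (d * C)) _) _.
    move=> x Ox; rewrite normrM; have [xr|rx] := leP (sqnorm x) (r ^+ 2).
      by apply: ler_pM => //; exact: phid.
    have := nbhs_singleton (near_eq_partial i (fr x rx)).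
    by rewrite /= partial_cst => ->; rewrite normr0 mulr0 mulr_ge0// ltW.
  rewrite mulr_sumr mulr_sumr; apply: ler_sum => b' _.
  by rewrite Rintegral_cst// mulrA.
have CW : 0 <= C * W by rewrite mulr_ge0.
rewrite /d; move: (C * W) CW => w w0.
have -> : e / (2 * (w + 1)) * w = (e / 2) * (w / (w + 1)).
  by field; rewrite gt_eqF// ltr_wpDl.
by rewrite ler_piMr ?divr_ge0 ?ltW// ltr_pdivrMr ?mul1r ?ltrDl// ltr_wpDl.
Qed.

End normal_trace.

(** * Locality of the normal trace at the boundary *)

Section dead_zone.
Context {R : realType}.
Implicit Types d t : R.

(** Soft truncation: a C^1 perturbation of the identity that vanishes near 0, at scale
    [d], with derivative bounded independently of [d]. *)
Definition dead_zone d t := t * step (t ^+ 2 / d ^+ 2 - 1).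

Definition ddead_zone d t := step (t ^+ 2 / d ^+ 2 - 1) +
  t * (dstep (t ^+ 2 / d ^+ 2 - 1) * (2 * t / d ^+ 2)).

Lemma is_derive_dead_zone d t : is_derive t (1 : R) (dead_zone d) (ddead_zone d t).
Proof.
have D : is_derive t (1 : R) (fun t : R => t ^+ 2 / d ^+ 2 - 1) (2 * t / d ^+ 2).
  apply: (@is_derive_quadratic _ _ _ _ (d ^+ 2)^-1) => h.
  have -> : (t + h) ^+ 2 / d ^+ 2 - 1 - (t ^+ 2 / d ^+ 2 - 1) - 2 * t / d ^+ 2 * h =
      (d ^+ 2)^-1 * h ^+ 2 by ring.
  by rewrite ger0_norm// mulr_ge0 ?invr_ge0 ?sqr_ge0.
have Ds := is_derive1_comp (is_derive_step _) D.
have Did : is_derive t (1 : R) (id : R -> R) 1 by exact: is_derive_id.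
have := is_deriveM Did Ds.
rewrite (_ : id * _ = dead_zone d)// => -[dM eM]; split => //.
by rewrite eM /ddead_zone /GRing.scale/= mulr1 addrC.
Qed.

Lemma continuous_ddead_zone d : continuous (ddead_zone d).
Proof.
pose w t : R := t ^+ 2 / d ^+ 2 - 1.
have c1 : continuous w.
  move=> t; apply: cvgB; last exact: cvg_cst.
  by apply: cvgM; [exact: exprn_continuous|exact: cvg_cst].
have c2 : continuous (fun t => step (w t)).
  move=> t; apply: continuous_comp; first exact: c1.
  by apply/differentiable_continuous/derivable1_diffP; case: (is_derive_step (w t)).
have c3 : continuous (fun t => dstep (w t)).
  by move=> t; apply: continuous_comp; [exact: c1|exact: continuous_dstep].
move=> t; apply: cvgD; first exact: c2.
apply: cvgM; first exact: cvg_id.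
apply: cvgM; first exact: c3.
by apply: cvgM; [apply: cvgM; [exact: cvg_cst|exact: cvg_id]|exact: cvg_cst].
Qed.

Lemma dead_zone_eq0 d t : `|t| <= d -> dead_zone d t = 0.
Proof.
move=> td; rewrite /dead_zone step_le0 ?mulr0// subr_le0.
have [->|d0] := eqVneq d 0; first by rewrite expr0n/= invr0 mulr0.
have dp : 0 < d by rewrite lt_neqAle eq_sym d0 (le_trans _ td).
rewrite ler_pdivrMr ?exprn_gt0// mul1r -[leLHS]ger0_norm ?sqr_ge0// normrX.
by rewrite lerXn2r// nnegrE// ltW.
Qed.

Lemma dist_dead_zone_le d t : 0 < d -> `|t - dead_zone d t| <= 2 * d.
Proof.
move=> d0; have dd : 0 < d ^+ 2 by rewrite exprn_gt0.
rewrite /dead_zone -[X in X - _]mulr1 -mulrBr normrM.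
have [s0 s1] := andP (step_bound (t ^+ 2 / d ^+ 2 - 1)).
have [td|dt] := leP (t ^+ 2) (2 * d ^+ 2); last first.
  rewrite step_ge1 ?subrr ?normr0 ?mulr0 ?mulr_ge0 ?ltW//.
  have : 2 < t ^+ 2 / d ^+ 2 by rewrite ltr_pdivlMr.
  lra.
have t2 : `|t| <= 2 * d by rewrite ler_norml; apply/andP; split; nra.
apply: le_trans t2; rewrite ler_piMr// ger0_norm ?subr_ge0//; lra.
Qed.

Lemma norm_dead_zone_le d t : `|dead_zone d t| <= `|t|.
Proof.
rewrite /dead_zone normrM.
have [s0 s1] := andP (step_bound (t ^+ 2 / d ^+ 2 - 1)).
rewrite ler_piMr// ger0_norm ?subr_ge0//; lra.
Qed.

Lemma ddead_zone_le d t : 0 < d -> `|ddead_zone d t| <= 9.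
Proof.
move=> d0; rewrite /ddead_zone; have dd : 0 < d ^+ 2 by rewrite exprn_gt0.
set w := t ^+ 2 / d ^+ 2 - 1.
have [s0 s1] := andP (step_bound w); have [a0 a1] := andP (dstep_bound w).
have -> : t * (dstep w * (2 * t / d ^+ 2)) = dstep w * (2 * (w + 1)).
  by rewrite /w; field; rewrite gt_eqF.
have w0 : 0 <= w + 1 by rewrite /w subrK divr_ge0 ?sqr_ge0.
have [/andP[w1 w2]|/dstep_eq0 ->] := boolP (0 < w < 1).
  rewrite ger0_norm; nra.
by rewrite mul0r addr0 ger0_norm//; lra.
Qed.

End dead_zone.

Section normal_trace_boundary.
Context {R : realType} {n : nat}.
Variables (Omega : set 'rV[R]_n) (F : 'I_n -> signed_measure R n)
  (nu : signed_measure R n) (E : set (Borel R n)).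
Hypotheses (Omega_open : open Omega) (F_nu : is_divergence Omega F nu).
Hypotheses (mE : measurable E) (E_sub : E `<=` Omega).

Local Notation Ev := (E : set 'rV[R]_n).

Lemma boundary_cases x : [\/ Ev° x, ~ closure Ev x | boundary Ev x].
Proof.
have [?|nint] := pselect (Ev° x); first exact: Or31.
by have [?|?] := pselect (closure Ev x); [apply: Or33|apply: Or32].
Qed.

(** Since [g] vanishes near the boundary of [E] and far away, its product with the
    indicator of [E] is of class C^1 with compact support in Omega, and its gradient is
    that of [g] on [E] and 0 elsewhere.  The divergence formula for this product is the
    claim. *)
Lemma normal_trace_eq0 (g : 'rV[R]_n -> R) (c : R) : C1 Omega g ->
  (forall x, c <= sqnorm x -> g x = 0) ->
  (forall x, boundary Ev x -> \forall y \near within Omega (nbhs x), g y = 0) ->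
  normal_trace F nu E g = 0.
Proof.
move=> Cg gc gb; pose f x := \1_Ev x * g x : R.
(* Near a boundary point both f and g vanish, so it does not matter whether that
   point belongs to E. *)
have fcase x : Omega x -> {near x, f =1 g} /\ E x \/
   {near x, f =1 fun=> 0} /\ (~ E x \/ {near x, g =1 fun=> 0}).
  move=> Ox; have [Ex|Ex|Ex] := boundary_cases x.
  - left; split; last exact: (nbhs_singleton Ex).
    by move: Ex; apply: filterS => y Ey; rewrite /f indicE mem_set// mul1r.
  - right; split; last by left => /subset_closure.
    have oC : open (~` closure Ev) by apply: closed_openC; exact: closed_closure.
    move: (open_nbhs_nbhs (conj oC Ex)); apply: filterS => y nEy.
    by rewrite /f indicE memNset ?mul0r// => /subset_closure.
  - have g0 : {near x, g =1 fun=> 0}.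
      have gx : nbhs x [set y | Omega y -> g y = 0] := gb x Ex.
      by apply: filterS2 gx (open_nbhs_nbhs (conj Omega_open Ox)) => y gy /gy.
    right; split; last by right.
    by move: g0; apply: filterS => y /= gy; rewrite /f gy mulr0.
have df i x : Omega x -> partial i f x = \1_E x * partial i g x.
  move=> Ox; rewrite indicE; have [[fg Ex]|[f0 [Ex|g0]]] := fcase x Ox.
  - by rewrite (mem_set Ex) mul1r; exact: nbhs_singleton (near_eq_partial i fg).
  - have := nbhs_singleton (near_eq_partial i f0).
    by rewrite /= partial_cst memNset// mul0r.
  - have := nbhs_singleton (near_eq_partial i f0).
    have := nbhs_singleton (near_eq_partial i g0).
    by rewrite /= !partial_cst => -> ->; rewrite mulr0.
have Cf : C1c Omega f.
  split.
  - apply: C1_local => x Ox; have [[fg _]|[f0 _]] := fcase x Ox.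
      by exists g => //; apply: C1_sub Cg => _ ->.
    by exists (fun=> 0) => //; exact: C1_cst.
  - have cB : compact [set x : 'rV[R]_n | sqnorm (x - 0) <= c] by exact: compact_sqball.
    apply: (subclosed_compact (@closed_closure _ _) cB).
    have /closure_id -> := compact_closed (@norm_hausdorff _ _) cB.
    apply: closure_subset => x [_] /=; rewrite subr0; apply: contraNT.
    by rewrite -ltNge => /ltW/gc gx; rewrite /f gx mulr0.
  - move=> x Sx; have [Ex|Ex|Ex] := boundary_cases x.
    + exact/E_sub/(nbhs_singleton Ex).
    + exfalso; apply: Ex; apply: closure_subset Sx => y [_].
      by apply: contraNP => Ey; rewrite /f indicE memNset// mul0r.
    + have [y [[Oy fy] gy]] := Sx _ (gb x Ex).
      by move: fy; rewrite /f gy// mulr0 eqxx.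
have := F_nu.2 _ Cf.
have -> : grad_integral F Omega f = grad_integral F E g.
  apply: eq_bigr => i _; rewrite (charge_integral_indic _ _ E_sub).
  by apply: eq_charge_integral => x; exact: df.
rewrite /normal_trace (charge_integral_indic nu g E_sub) => ->.
by rewrite opprK subrr.
Qed.

(** Compare [phi] with the function [g] obtained by truncating it softly at height [d] and
    cutting it off at a large radius: the trace of [g] is 0, and [phi - g] is small on a
    large ball. *)
Lemma normal_trace_boundary (K e : R) : 0 <= K -> 0 < e ->
  exists2 d : R, 0 < d & forall phi, C1_le Omega K phi ->
    (forall x, boundary Ev x -> sqnorm x <= d^-1 ->
       \forall y \near within Omega (nbhs x), `|phi y| < d) ->
    `|normal_trace F nu E phi| <= e.
Proof.
move=> K0 e0.
(* 18 K bounds phi - g: K for phi, 9 K for the truncation and 8 K for the cutoff. *)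
have K180 : 0 <= 18 * K by rewrite mulr_ge0.
have [r [d0 [r1 d00 trK]]] := normal_trace_continuous Omega_open F_nu mE E_sub K180 e0.
have r0 : 0 < r by apply: lt_le_trans r1.
(* The first bound makes the truncation error at most d0; the second makes the
   boundary condition available on the whole support of the cutoff. *)
pose d := Num.min (d0 / 2) (2 * r ^+ 2 + 1)^-1.
have rr : 0 < 2 * r ^+ 2 + 1 by rewrite ltr_wpDl// mulr_ge0 ?sqr_ge0.
have dp : 0 < d by rewrite lt_min divr_gt0//= invr_gt0.
have dd0 : 2 * d <= d0 by rewrite mulrC -ler_pdivlMr// ge_min lexx.
have dr : 2 * r ^+ 2 < d^-1.
  have : d <= (2 * r ^+ 2 + 1)^-1 by rewrite ge_min lexx orbT.
  by rewrite -[X in X <= _]invrK lef_pV2 ?posrE ?invr_gt0//; lra.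
exists d => // phi c phib; have [Cphi phiK dphiK] := c.
have Cu : C1 Omega (fun x => dead_zone d (phi x)).
  exact: (C1_comp Omega_open (@is_derive_dead_zone R d) (@continuous_ddead_zone R d) Cphi).
have Cc : C1 Omega (cutoff (0 : 'rV[R]_n) r) by exact: C1_cutoff.
pose g x := cutoff (0 : 'rV[R]_n) r x * dead_zone d (phi x).
have Cg : C1 Omega g by exact: (C1M Omega_open Cc Cu).
have g0 : normal_trace F nu E g = 0.
  apply: (normal_trace_eq0 (c := 2 * r ^+ 2) Cg) => [x xr|x Ex].
    by rewrite /g cutoff_eq0 ?subr0 ?mul0r.
  have [xd|dx] := leP (sqnorm x) d^-1.
    by move: (phib x Ex xd); apply: filterS => y /ltW/dead_zone_eq0 gy; rewrite /g gy mulr0.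
  have : \forall y \near x, 2 * r ^+ 2 < sqnorm (y - 0).
    have cs : {for x, continuous (fun y : 'rV[R]_n => sqnorm (y - 0))}.
      exact: C1_continuous (C1_sqnorm 0 openT) I.
    have dx' : 2 * r ^+ 2 < sqnorm (x - 0) by rewrite subr0; exact: lt_trans dx.
    exact: (cvgr_gt _ cs _ dx').
  move=> xr; rewrite near_withinE; apply: filterS xr => y /ltW yr _.
  by rewrite /g cutoff_eq0 ?mul0r.
have cg : C1_le Omega (17 * K) g.
  split => // [x Ox|i x Ox].
    rewrite /g normrM; have /andP[c0 c1] := cutoff_bound 0 r x.
    rewrite (ger0_norm c0); apply: le_trans (ler_piMl _ c1) _ => //.
    apply: le_trans (norm_dead_zone_le _ _) _; apply: le_trans (phiK x Ox) _.
    by rewrite ler_peMl// ler1n.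
  rewrite partialM; [|exact: Cc.1|exact: Cu.1].
  rewrite (partial_comp i (@is_derive_dead_zone R d) (Cphi.1 x Ox)).
  apply: le_trans (ler_normD _ _) _; rewrite (_ : 17 * K = 9 * K + K * 8); last by ring.
  have /andP[c0 c1] := cutoff_bound 0 r x.
  apply: lerD.
    rewrite normrM (ger0_norm c0); apply: le_trans (ler_piMl _ c1) _ => //.
    by rewrite normrM ler_pM//; [exact: ddead_zone_le|exact: dphiK].
  rewrite normrM; apply: ler_pM => //.
    by apply: le_trans (norm_dead_zone_le _ _) _; exact: phiK.
  apply: le_trans (partial_cutoff_le _ _ _ r0) _.
  by rewrite ler_pdivrMr// ler_peMr.
have cpg : C1_le Omega (18 * K) (fun x => phi x - g x).
  by rewrite (_ : 18 * K = K + 17 * K); [exact: C1_leB|ring].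
have -> : normal_trace F nu E phi = normal_trace F nu E (fun x => phi x - g x).
  by rewrite (normal_traceB F nu Omega_open mE E_sub c cg)// g0 subr0.
apply: trK => // x Ox xr; apply: le_trans dd0; rewrite /g cutoff_eq1 ?subr0// mul1r.
exact: dist_dead_zone_le.
Qed.

End normal_trace_boundary.

(** * Grid hats and Lipschitz extension *)

Section grid_hat.
Context {R : realType}.
Implicit Types t : R.

(** The translates of [hat] by integers form a partition of unity since their sum
    telescopes. *)
Definition hat t := step (t + 1) - step t.

Definition dhat t := dstep (t + 1) - dstep t.

Lemma is_derive_hat t : is_derive t (1 : R) hat (dhat t).
Proof.
have D : is_derive t (1 : R) (fun t : R => t + 1) 1.
  apply: (@is_derive_quadratic _ _ _ _ 0) => h.
  by rewrite (_ : _ - _ = 0) ?normr0 ?mul0r//; ring.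
have D1 := @is_derive1_comp R step (fun t : R => t + 1) t _ _ (is_derive_step (t + 1)) D.
have [dM eM] := is_deriveB D1 (is_derive_step t).
by split => //; rewrite eM mulr1.
Qed.

Lemma continuous_dhat : continuous dhat.
Proof.
move=> t; apply: cvgB; last exact: continuous_dstep.
apply: (@continuous_comp _ _ _ (fun t : R => t + 1)); last exact: continuous_dstep.
by apply: cvgD; [exact: cvg_id|exact: cvg_cst].
Qed.

Lemma hat_ge0 t : 0 <= hat t.
Proof.
rewrite /hat; have [t0|t0] := leP t 0.
  by rewrite (step_le0 t0) subr0; have /andP[] := step_bound (t + 1).
rewrite (@step_ge1 _ (t + 1)); last by lra.
by rewrite subr_ge0; have /andP[] := step_bound t.
Qed.

Lemma hat_eq0 t : 1 <= `|t| -> hat t = 0.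
Proof.
rewrite ler_normr => /orP[t1|t1]; rewrite /hat.
  by rewrite !step_ge1 ?subrr//; lra.
by rewrite !step_le0 ?subrr//; lra.
Qed.

Lemma dhat_eq0 t : 1 <= `|t| -> dhat t = 0.
Proof.
rewrite ler_normr /dhat => /orP[t1|t1]; rewrite !dstep_eq0 ?subrr// negb_and -!leNgt;
  apply/orP; (by left; lra) || (by right; lra).
Qed.

Lemma sum_hat m t : - m%:R <= t <= m%:R ->
  \sum_(j < m.*2.+1) hat (t - (j%:R - m%:R)) = 1.
Proof.
move=> /andP[t1 t2]; pose f (j : nat) := - step (t + m%:R + 1 - j%:R).
rewrite (_ : \sum_(j < _) _ = \sum_(0 <= j < m.*2.+1) (f j.+1 - f j)).
  rewrite telescope_sumr// /f opprK -addnn -addn1 !natrD subr0.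
  by rewrite step_le0 ?step_ge1 ?oppr0 ?add0r//; lra.
rewrite big_mkord; apply: eq_bigr => j _; rewrite /f /hat opprK [RHS]addrC -[in RHS]natr1.
by congr (step _ - step _); ring.
Qed.

Lemma sum_dhat m t : - m%:R <= t <= m%:R ->
  \sum_(j < m.*2.+1) dhat (t - (j%:R - m%:R)) = 0.
Proof.
move=> /andP[t1 t2]; pose f (j : nat) := - dstep (t + m%:R + 1 - j%:R).
rewrite (_ : \sum_(j < _) _ = \sum_(0 <= j < m.*2.+1) (f j.+1 - f j)).
  rewrite telescope_sumr// /f opprK -addnn -addn1 !natrD subr0.
  by rewrite !dstep_eq0 ?oppr0 ?addr0// negb_and -!leNgt; apply/orP;
    (by left; lra) || (by right; lra).
rewrite big_mkord; apply: eq_bigr => j _; rewrite /f /dhat opprK [RHS]addrC -[in RHS]natr1.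
by congr (dstep _ - dstep _); ring.
Qed.

(** The translates of [dstep] by integers have disjoint supports; this is made quantitative
    by a telescoping bound with the indicator of the positive half-line. *)
Lemma sum_dstep_le N t : \sum_(j < N) dstep (t - j%:R) <= 2.
Proof.
pose h (s : R) : R := (0 < s)%R%:R.
have dh s : dstep s <= 2 * (h s - h (s - 1)).
  rewrite /h; have [/andP[s0 s1]|/dstep_eq0 ->] := boolP (0 < s < 1).
    rewrite s0 (_ : (0 < s - 1) = false) ?subr0 ?mulr1; last by apply/negbTE; lra.
    by have /andP[] := dstep_bound s.
  rewrite mulr_ge0// subr_ge0 ler_nat; case: (ltP 0 s) => s0; first exact: leq_b1.
  by rewrite (_ : (0 < s - 1) = false)//; apply/negbTE; lra.
apply: le_trans (ler_sum _ (fun j _ => dh _)) _.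
rewrite -mulr_sumr -[leRHS]mulr1 ler_wpM2l//.
pose f (j : nat) := - h (t - j%:R).
rewrite (_ : \sum_(j < _) _ = \sum_(0 <= j < N) (f j.+1 - f j)).
  rewrite telescope_sumr// /f opprK subr0 addrC lerBlDr.
  by rewrite /h; case: (0 < t); case: (0 < _) => /=; lra.
rewrite big_mkord; apply: eq_bigr => j _; rewrite /f opprK [RHS]addrC -[in RHS]natr1.
by congr (_ - h _); ring.
Qed.

Lemma sum_dhat_le m t : \sum_(j < m.*2.+1) `|dhat (t - (j%:R - m%:R))| <= 4.
Proof.
have -> : 4 = 2 + 2 :> R by ring.
apply: le_trans (lerD (sum_dstep_le m.*2.+1 (t + m%:R + 1)) (sum_dstep_le m.*2.+1 (t + m%:R))).
rewrite -big_split/=; apply: ler_sum => j _.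
have d0 s : 0 <= dstep s :> R by case/andP: (dstep_bound s).
apply: le_trans (ler_normB _ _) _; rewrite !ger0_norm//.
by rewrite le_eqVlt; apply/orP; left; apply/eqP; congr (dstep _ + dstep _); ring.
Qed.

End grid_hat.

Section mcshane.
Context {R : realType} {n : nat}.
Variables (X : set 'rV[R]_n) (psi : X -> R) (M : R).
Hypotheses (M0 : 0 <= M) (psiM : forall x, `|psi x| <= M).
Hypothesis (psiL : forall x y, `|psi x - psi y| <= M * l1norm (val x - val y)).

(** McShane's formula, the infimum of [psi y + M * l1norm (x - y)] over [y] in [X],
    truncated from above at [M]. *)
Lemma mcshane_extension : exists Phi : 'rV[R]_n -> R,
  [/\ forall x, `|Phi x| <= M, forall x y, `|Phi x - Phi y| <= M * l1norm (x - y) &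
      forall x : X, Phi (val x) = psi x].
Proof.
have [x0|noX] := pselect (inhabited X); last first.
  exists (fun=> 0); split => [x|x y|x]; rewrite ?subrr ?normr0 ?mulr_ge0 ?l1norm_ge0//.
  by exfalso; apply: noX; constructor.
case: x0 => x0.
pose G x := [set psi y + M * l1norm (x - val y) | y in [set: X]].
have G0 x : G x !=set0 by exists (psi x0 + M * l1norm (x - val x0)); exists x0.
have Glb x : lbound (G x) (- M).
  move=> _ [y _ <-]; rewrite -[leLHS]addr0 lerD ?mulr_ge0 ?l1norm_ge0//.
  by have := psiM y; rewrite ler_norml => /andP[].
have Ginf x : has_inf (G x) by split => //; exists (- M).
pose P x := inf (G x).
have P1 x : - M <= P x by exact: lb_le_inf.
have P2 x y : P x <= psi y + M * l1norm (x - val y).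
  by apply: ge_inf; [exists (- M); exact: Glb|exists y].
have PL x y : P x <= P y + M * l1norm (x - y).
  rewrite -lerBlDr; apply: lb_le_inf => // _ [z _ <-].
  rewrite lerBlDr; apply: le_trans (P2 x z) _.
  rewrite -addrA lerD2l -mulrDr ler_wpM2l//.
  have -> : x - val z = (y - val z) + (x - y) by rewrite [RHS]addrC addrA subrK.
  exact: l1normD.
have PX (x : X) : P (val x) = psi x.
  apply/eqP; rewrite eq_le; apply/andP; split.
    apply: le_trans (P2 _ x) _; rewrite subrr /l1norm big1 ?mulr0 ?addr0//.
    by move=> i _; rewrite mxE normr0.
  apply: lb_le_inf => // _ [y _ <-].
  rewrite -lerBlDl; apply: le_trans (ler_norm _) (psiL x y).
exists (fun x => Num.min (P x) M); split => [x|x y|x].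
- by rewrite ler_norml le_min P1 ge_min lexx orbT ge0_cp.
- have l0 : 0 <= M * l1norm (x - y) by rewrite mulr_ge0 ?l1norm_ge0.
  have := PL x y; have := PL y x; rewrite [l1norm (y - x)]l1normB => h1 h2.
  by rewrite ler_norml /Num.min; case: (ltP (P x) M) => a; case: (ltP (P y) M) => b;
    apply/andP; split; lra.
- by rewrite PX min_l//; apply: le_trans (ler_norm _) (psiM x).
Qed.

End mcshane.

(** * Smooth approximation of Lipschitz functions *)

Section smoothing.
Context {R : realType} {n : nat}.
Implicit Types (x y : 'rV[R]_n).

(** The mean value theorem on the segment from [y] to [x]. *)
Lemma C1_le_lipschitz (K : R) (phi : 'rV[R]_n -> R) x y : C1_le setT K phi ->
  `|phi x - phi y| <= K * l1norm (x - y).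
Proof.
move=> [[dphi _] _ Kphi]; pose v := x - y; pose g (t : R) := phi (t *: v + y).
have Dv z : `|'D_v phi z| <= K * l1norm v.
  rewrite deriveE; last exact: dphi.
  rewrite [X in 'd phi z X](row_sum_delta v) linear_sum/=.
  apply: le_trans (ler_norm_sum _ _ _) _; rewrite /l1norm mulr_sumr.
  apply: ler_sum => i _; rewrite linearZ/= normrM mulrC ler_wpM2r//.
  by rewrite -deriveE; [exact: Kphi|exact: dphi].
have dg (t : R) : is_derive t (1 : R) g ('D_v phi (t *: v + y)).
  have H : h^-1 *: (g (h *: 1 + t) - g t) @[h --> (0 : R)^'] --> 'D_v phi (t *: v + y).
    have dd : derivable phi (t *: v + y) v by apply: diff_derivable; exact: dphi.
    apply: cvg_trans dd.
    apply: near_eq_cvg; near=> h; rewrite /= /g.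
    have -> : h *: (1 : R) + t = h + t by rewrite /GRing.scale/= mulr1.
    by rewrite scalerDl -addrA.
  by split; [apply/cvg_ex; eexists; exact: H|apply/cvg_lim].
have gc : {within `[0, 1], continuous g}.
  apply: continuous_subspaceT => t; apply: differentiable_continuous.
  by apply/derivable1_diffP; case: (dg t).
have [c _] := MVT (ltr01 : (0 : R) < 1) (fun t _ => dg t) gc.
rewrite subr0 mulr1 /g scale1r scale0r add0r /v subrK => ->.
exact: Dv.
Unshelve. all: by end_near. Qed.

(** A weighted sum of values close to [c], with total weight [A], is close to [c * A].  It is
    used with [A = 1] for the interpolant and with [A = 0] for its derivatives. *)
Lemma linear_comb_le_weights (I : finType) (a w : I -> R) (A c e S : R) :
  \sum_i w i = A -> (forall i, w i != 0 -> `|a i - c| <= e) ->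
  \sum_i `|w i| <= S -> 0 <= e -> `|\sum_i a i * w i - c * A| <= e * S.
Proof.
move=> <- ae wS e0; rewrite mulr_sumr -sumrB.
apply: le_trans (ler_norm_sum _ _ _) _.
apply: (@le_trans _ _ (e * \sum_i `|w i|)); last by rewrite ler_wpM2l.
rewrite mulr_sumr; apply: ler_sum => i _; rewrite -mulrBl normrM.
have [->|wi] := eqVneq (w i) 0; first by rewrite normr0 !mulr0.
by rewrite ler_wpM2r// ae.
Qed.

Section grid.
Variables (h : R) (m : nat).
Hypothesis h0 : 0 < h.

Local Notation idx := {ffun 'I_n -> 'I_m.*2.+1}.

Definition node (k : idx) : 'rV[R]_n := \row_i (h * ((k i)%:R - m%:R)).

Definition hat_at (k : idx) (x : 'rV[R]_n) : R :=
  \prod_i hat (x ord0 i / h - ((k i)%:R - m%:R)).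

Definition dhat_at (j : 'I_n) (k : idx) (x : 'rV[R]_n) : R :=
  \prod_i if i == j then dhat (x ord0 i / h - ((k i)%:R - m%:R)) / h
          else hat (x ord0 i / h - ((k i)%:R - m%:R)).

(** Interpolation of [Phi] on a finite grid of mesh [h] by tensor products of hats. *)
Definition interpolant (Phi : 'rV[R]_n -> R) x := \sum_k Phi (node k) * hat_at k x.

Lemma C1_rescaled_coord D i (c : R) : open D ->
  C1 D (fun x : 'rV[R]_n => x ord0 i / h - c).
Proof.
move=> oD; apply: C1B => //; last exact: C1_cst.
exact: (C1M oD (C1_coord D i) (C1_cst D h^-1)).
Qed.

Lemma C1_hat_factor i (c : R) :
  C1 setT (fun x : 'rV[R]_n => hat (x ord0 i / h - c)).
Proof.
apply: (C1_comp openT (@is_derive_hat R) (@continuous_dhat R)).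
by apply: C1_rescaled_coord; exact: openT.
Qed.

Lemma C1_hat_at k : C1 setT (hat_at k).
Proof. by apply: C1_prod; [exact: openT|move=> i _; exact: C1_hat_factor]. Qed.

Lemma C1_interpolant Phi : C1 setT (interpolant Phi).
Proof.
apply: C1_sum; first exact: openT.
by move=> k _; apply: C1Z; [exact: openT|exact: C1_hat_at].
Qed.

Lemma partial_hat_at j k x : partial j (hat_at k) x = dhat_at j k x.
Proof.
pose c i : R := (k i)%:R - m%:R.
pose f1 x := hat (x ord0 j / h - c j).
pose f2 x := \prod_(i | i != j) hat (x ord0 i / h - c i).
have -> : hat_at k = fun x => f1 x * f2 x.
  by apply/funext => y; rewrite /hat_at (bigD1 j).
have d1 : differentiable f1 x by apply: (C1_hat_factor j (c j)).1.
have d2 : differentiable f2 x.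
  have [+ _] : C1 setT f2 by apply: C1_prod; [exact: openT|move=> i _; exact: C1_hat_factor].
  exact.
rewrite partialM// (_ : partial j f2 x = 0); last first.
  apply: partial_affine => t; rewrite mulr0 addr0; apply: eq_bigr => i ij.
  by rewrite !mxE (negbTE ij) andbF mulr0 add0r.
have dl : differentiable (fun x : 'rV[R]_n => x ord0 j / h - c j) x.
  by apply: (C1_rescaled_coord j (c j) openT).1.
rewrite mulr0 add0r (partial_comp j (@is_derive_hat R) dl).
rewrite (_ : partial j _ x = h^-1); last first.
  by apply: partial_affine => t; rewrite !mxE !eqxx mulr1; ring.
rewrite /dhat_at (bigD1 j)//= eqxx mulrC; congr (_ * _).
by apply: eq_bigr => i /negbTE ->.
Qed.

Lemma partial_interpolant j Phi x :
  partial j (interpolant Phi) x = \sum_k Phi (node k) * dhat_at j k x.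
Proof.
rewrite (@partial_sum _ _ setT)//; last 2 first.
- exact: openT.
- by move=> k _; apply: C1Z; [exact: openT|exact: C1_hat_at].
apply: eq_bigr => k _; have dk : differentiable (hat_at k) x by apply: (C1_hat_at k).1.
by rewrite partialM// partial_cst mulr0 addr0 partial_hat_at.
Qed.

Lemma node_near (k : idx) x :
  (forall i, `|x ord0 i / h - ((k i)%:R - m%:R)| < 1) -> l1norm (node k - x) <= n%:R * h.
Proof.
move=> xk; rewrite -[n in n%:R]card_ord mulr_natl -sumr_const.
apply: ler_sum => i _; rewrite !mxE.
have -> : h * ((k i)%:R - m%:R) - x ord0 i =
    - (h * (x ord0 i / h - ((k i)%:R - m%:R))) by field; rewrite gt_eqF.
by rewrite normrN normrM (gtr0_norm h0) ler_piMr// ltW.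
Qed.

Lemma node_near_hat k x : hat_at k x != 0 -> l1norm (node k - x) <= n%:R * h.
Proof.
rewrite /hat_at => /prodf_neq0 ne0; apply: node_near => i.
by rewrite ltNge; apply: contra (ne0 i isT) => /hat_eq0 ->.
Qed.

Lemma node_near_dhat j k x : dhat_at j k x != 0 -> l1norm (node k - x) <= n%:R * h.
Proof.
rewrite /dhat_at => /prodf_neq0 ne0; apply: node_near => i.
rewrite ltNge; apply: contra (ne0 i isT) => c1.
by case: ifP => _; rewrite ?(hat_eq0 c1)// (dhat_eq0 c1) mul0r.
Qed.

Section inside.
Variable x : 'rV[R]_n.
Hypothesis xhm : forall i, `|x ord0 i| <= h * m%:R.

Let coord_in i : - m%:R <= x ord0 i / h <= m%:R.
Proof.
by rewrite -ler_norml normrM normfV (gtr0_norm h0) ler_pdivrMr// mulrC xhm.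
Qed.

Lemma sum_hat_at : \sum_k hat_at k x = 1.
Proof.
rewrite /hat_at -(bigA_distr_bigA (fun i (l : 'I_m.*2.+1) =>
  hat (x ord0 i / h - (l%:R - m%:R)))).
by apply: big1 => i _; exact: sum_hat.
Qed.

Lemma sum_dhat_at j : \sum_k dhat_at j k x = 0.
Proof.
rewrite /dhat_at -(bigA_distr_bigA (fun i (l : 'I_m.*2.+1) =>
  if i == j then dhat (x ord0 i / h - (l%:R - m%:R)) / h
  else hat (x ord0 i / h - (l%:R - m%:R)))).
by rewrite (bigD1 j)//= eqxx -mulr_suml sum_dhat// !mul0r.
Qed.

Lemma sum_dhat_at_le j : \sum_k `|dhat_at j k x| <= 4 / h.
Proof.
rewrite /dhat_at; under eq_bigr do rewrite normr_prod.
rewrite -(bigA_distr_bigA (fun i (l : 'I_m.*2.+1) =>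
  `|if i == j then dhat (x ord0 i / h - (l%:R - m%:R)) / h
    else hat (x ord0 i / h - (l%:R - m%:R))|)).
rewrite (bigD1 j)//= eqxx [X in _ * X]big1 ?mulr1; last first.
  move=> i /negbTE ->; under eq_bigr do rewrite ger0_norm ?hat_ge0//.
  exact: sum_hat.
under eq_bigr do rewrite normrM normfV (gtr0_norm h0).
by rewrite -mulr_suml ler_pM2r ?invr_gt0// sum_dhat_le.
Qed.

Variables (Phi : 'rV[R]_n -> R) (M : R).
Hypotheses (M0 : 0 <= M) (PhiM : forall y, `|Phi y| <= M).
Hypothesis PhiL : forall y z, `|Phi y - Phi z| <= M * l1norm (y - z).

Lemma interpolant_near : `|interpolant Phi x - Phi x| <= M * (n%:R * h).
Proof.
rewrite -[X in _ - X]mulr1 -[leRHS]mulr1.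
apply: linear_comb_le_weights => [|k /node_near_hat kx||].
- exact: sum_hat_at.
- by apply: le_trans (PhiL _ _) _; rewrite ler_wpM2l.
- rewrite le_eqVlt -[X in _ == X]sum_hat_at; apply/orP; left; apply/eqP.
  by apply: eq_bigr => k _; rewrite ger0_norm// prodr_ge0// => i _; exact: hat_ge0.
- by rewrite !mulr_ge0// ltW.
Qed.

Lemma interpolant_le : `|interpolant Phi x| <= M.
Proof.
have := @linear_comb_le_weights _ (fun k => Phi (node k)) (hat_at^~ x) 1 0 M 1.
rewrite mul0r subr0 mulr1; apply => //; first exact: sum_hat_at.
  by move=> k _; rewrite subr0.
rewrite le_eqVlt -[X in _ == X]sum_hat_at; apply/orP; left; apply/eqP.
by apply: eq_bigr => k _; rewrite ger0_norm// prodr_ge0// => i _; exact: hat_ge0.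
Qed.

(** The derivatives of the hats sum to 0, so [Phi (node k)] may be replaced by the difference
    [Phi (node k) - Phi x], of order [M * h], which compensates the factor [1 / h]. *)
Lemma partial_interpolant_le j : `|partial j (interpolant Phi) x| <= 4 * n%:R * M.
Proof.
rewrite partial_interpolant.
have := @linear_comb_le_weights _ (fun k => Phi (node k)) (dhat_at j ^~ x)
  0 (Phi x) (M * (n%:R * h)) (4 / h).
rewrite mulr0 subr0 (_ : 4 * n%:R * M = M * (n%:R * h) * (4 / h)); last first.
  by field; rewrite gt_eqF.
apply => //.
- exact: sum_dhat_at.
- by move=> k /node_near_dhat kx; apply: le_trans (PhiL _ _) _; rewrite ler_wpM2l.
- exact: sum_dhat_at_le.
- by rewrite !mulr_ge0// ltW.
Qed.

End inside.
End grid.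

(** Extend, interpolate on a grid that is fine enough for [delta] and large enough to cover
    the support of a cutoff, and multiply by that cutoff.  The constant depends on the
    dimension only. *)
Lemma C1_approximation (X : set 'rV[R]_n) (psi : X -> R) (M rho delta : R) :
  0 <= M -> 0 < delta -> 0 <= rho -> (forall x : X, `|psi x| <= M) ->
  (forall x y : X, `|psi x - psi y| <= M * l1norm (val x - val y)) ->
  exists2 phi, C1_le setT ((4 * n%:R + 8) * M) phi &
    forall x : X, sqnorm (val x) <= rho -> `|phi (val x) - psi x| <= delta.
Proof.
move=> M0 d0 rho0 psiM psiL.
have [Phi [PhiM PhiL PhiX]] := mcshane_extension M0 psiM psiL.
have Mn0 : 0 < M * n%:R + 1 by rewrite ltr_wpDl// mulr_ge0.
pose h := delta / (M * n%:R + 1); have h0 : 0 < h by rewrite divr_gt0.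
pose r := 1 + rho; have r1 : 1 <= r by rewrite lerDl.
have r0 : 0 < r by apply: lt_le_trans r1.
have [m mr] : exists m : nat, 2 * r <= h * m%:R.
  exists (Num.bound (h^-1 * (2 * r))); rewrite -ler_pdivrMl//.
  by apply/ltW; apply: archi_boundP; rewrite !mulr_ge0 ?invr_ge0 ?ltW.
have inside x i : sqnorm x <= 2 * r ^+ 2 -> `|x ord0 i| <= h * m%:R.
  move=> xr; apply: le_trans mr; apply: le_trans (coord_le_norm x i) _.
  by apply: norm_le_sqnorm; [lra|nra].
pose phi x := cutoff (0 : 'rV[R]_n) r x * interpolant h m Phi x.
have oT := @openT 'rV[R]_n.
have Cc : C1 setT (cutoff (0 : 'rV[R]_n) r) by exact: C1_cutoff.
have CI := C1_interpolant h m Phi.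
have n0 : 0 <= n%:R :> R by exact: ler0n.
have B0 : 0 <= (4 * n%:R + 8) * M by rewrite mulr_ge0 ?addr_ge0 ?mulr_ge0.
exists phi; last first.
  move=> x xr; have xr2 : sqnorm (val x) <= r ^+ 2.
    by rewrite (le_trans xr)// /r; nra.
  rewrite /phi cutoff_eq1 ?subr0// mul1r -PhiX.
  have xi i : `|val x ord0 i| <= h * m%:R by apply: inside; nra.
  apply: le_trans (interpolant_near h0 xi M0 PhiL) _.
  rewrite mulrA /h mulrA ler_pdivrMr// mulrC ler_wpM2l ?ltW//; lra.
split; first exact: (C1M oT Cc CI).
- move=> x _; have [c0 c1] := andP (cutoff_bound 0 r x).
  have [xr|rx] := leP (sqnorm x) (2 * r ^+ 2); last first.
    by rewrite /phi cutoff_eq0 ?subr0 ?(ltW rx)// mul0r normr0.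
  rewrite /phi normrM (ger0_norm c0).
  apply: le_trans (ler_piMl _ c1) _ => //.
  apply: le_trans (interpolant_le h0 (fun i => inside x i xr) M0 PhiM) _.
  by nra.
move=> i x _; have [c0 c1] := andP (cutoff_bound 0 r x).
rewrite partialM; [|exact: Cc.1|exact: CI.1].
have [xr|rx] := leP (sqnorm x) (2 * r ^+ 2); last first.
  rewrite cutoff_eq0 ?subr0 ?(ltW rx)// partial_cutoff_eq0 ?subr0 ?(ltW rx)//.
  by rewrite mul0r mulr0 addr0 normr0.
rewrite mulrDl; apply: le_trans (ler_normD _ _) _.
rewrite [X in X + _]normrM [X in _ + X]normrM (ger0_norm c0).
apply: lerD.
  apply: le_trans (ler_piMl _ c1) _ => //.
  exact: (partial_interpolant_le h0 (fun i => inside x i xr) M0 PhiL).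
rewrite mulrC; apply: ler_pM => //.
  apply: le_trans (partial_cutoff_le _ _ _ r0) _.
  by rewrite ler_pdivrMr// ler_peMr.
exact: (interpolant_le h0 (fun i => inside x i xr) M0 PhiM).
Qed.

End smoothing.

(** * Hahn-Banach for finitely many constraints; the norm of Lip_b *)

(** If [N] is dominated by [p] on the common kernel of finitely many evaluations, then some
    linear combination of these evaluations is [p]-close to [N] everywhere.  The constraints
    are released one at a time, each by the usual one-dimensional extension step, so no
    maximality principle is involved. *)
Lemma finite_hahn_banach (R : realType) (V : lmodType R) (I : eqType)
    (ev : I -> V -> R) (p : V -> R) (s : seq I) (N : V -> R) :
  (forall i a f g, ev i (a *: f + g) = a * ev i f + ev i g) ->
  (forall f g, p (f - g) <= p f + p g) -> (forall a f, p (a *: f) <= `|a| * p f) ->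
  (forall a f g, N (a *: f + g) = a * N f + N g) ->
  (forall f, (forall i, i \in s -> ev i f = 0) -> `|N f| <= p f) ->
  exists c : seq (R * I), forall f, `|N f - \sum_(q <- c) q.1 * ev q.2 f| <= p f.
Proof.
move=> ev_lin pB pZ; elim: s N => [|x s IH] N N_lin Np.
  by exists [::] => f; rewrite big_nil subr0; exact: Np.
pose vanish f := forall i, i \in s -> ev i f = 0.
have linZ (L : V -> R) : (forall a f g, L (a *: f + g) = a * L f + L g) ->
    forall a f, L (a *: f) = a * L f.
  move=> L_lin; have L0 : L 0 = 0.
    have := L_lin 1 0 0; rewrite scale1r addr0 mul1r => /eqP.
    by rewrite -subr_eq0 opprD addNKr oppr_eq0 => /eqP.
  by move=> a f; rewrite -[a *: f]addr0 L_lin L0 addr0.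
have vanishZ a f : vanish f -> vanish (a *: f).
  by move=> vf i si; rewrite linZ ?vf ?mulr0.
have linB (L : V -> R) : (forall a f g, L (a *: f + g) = a * L f + L g) ->
    forall f g, L (f - g) = L f - L g.
  by move=> L_lin f g; rewrite addrC -scaleN1r L_lin mulN1r addrC.
have Np0 f : vanish f -> ev x f = 0 -> `|N f| <= p f.
  by move=> vf xf; apply: Np => i; rewrite inE => /predU1P[->//|]; exact: vf.
have [a aP] : exists a, forall f, vanish f -> `|N f - a * ev x f| <= p f.
  (* Any number between the supremum of A and the infimum of N g + p g would do. *)
  pose A := [set N f - p f | f in [set f | vanish f /\ ev x f = 1]].
  have scaled f : vanish f -> ev x f != 0 ->
      vanish ((ev x f)^-1 *: f) /\ ev x ((ev x f)^-1 *: f) = 1.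
    by move=> vf xf; split; [exact: vanishZ|rewrite linZ// mulVf].
  have [A0|/set0P A0] := eqVneq A set0.
    exists 0 => f vf; rewrite mul0r subr0; have [xf|xf] := eqVneq (ev x f) 0.
      exact: Np0.
    have : A (N ((ev x f)^-1 *: f) - p ((ev x f)^-1 *: f)).
      by exists ((ev x f)^-1 *: f) => //; exact: scaled.
    by rewrite A0.
  have ubA g : vanish g -> ev x g = 1 -> ubound A (N g + p g).
    move=> vg xg _ [f [vf xf] <-].
    have vfg : vanish (f - g) by move=> i si; rewrite linB// vf// vg// subrr.
    have : `|N (f - g)| <= p (f - g) by apply: Np0 => //; rewrite linB// xf xg subrr.
    rewrite linB// => Nfg; have := le_trans (ler_norm _) (le_trans Nfg (pB f g)).
    lra.
  have [_ [f0 [vf0 xf0] _]] := A0.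
  have supA : has_sup A by split => //; exists (N f0 + p f0); exact: ubA.
  have one g : vanish g -> ev x g = 1 -> `|N g - sup A| <= p g.
    move=> vg xg; have h1 : sup A <= N g + p g by apply: ge_sup => //; exact: ubA.
    have h2 : N g - p g <= sup A by apply: ub_le_sup; [exact: supA.2|exists g].
    by rewrite ler_norml; apply/andP; split; lra.
  exists (sup A) => f vf; have [xf|xf] := eqVneq (ev x f) 0.
    by rewrite xf mulr0 subr0; exact: Np0.
  have [vg xg] := scaled f vf xf; have := one _ vg xg.
  rewrite linZ// => fa.
  have -> : N f - sup A * ev x f = ev x f * ((ev x f)^-1 * N f - sup A) by field.
  rewrite normrM; apply: le_trans (ler_wpM2l (normr_ge0 _) fa) _.
  apply: le_trans (ler_wpM2l (normr_ge0 _) (pZ _ _)) _.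
  by rewrite normfV mulrA mulfV ?mul1r// normr_eq0.
have [||c cP] := IH (fun f => N f - a * ev x f).
- by move=> b f g; rewrite N_lin ev_lin; ring.
- by move=> f; exact: aP.
exists ((a, x) :: c) => f; rewrite big_cons/= opprD addrA; exact: cP.
Qed.

Section lipb_norm.
Context {R : realType} {n : nat}.
Variable X : set 'rV[R]_n.
Implicit Types (f g : Lipb X) (x y : X).

Lemma lipb_lin a f g x : (a *: f + g) x = a * f x + g x.
Proof. by []. Qed.

Lemma lipbB f g x : (f - g) x = f x - g x.
Proof. by []. Qed.

Lemma lipbP f : (exists M : R, forall x, `|f x| <= M) /\
  (exists L : R, forall x y, `|f x - f y| <= L * enorm (val x - val y)).
Proof. by have := valP f; rewrite inE. Qed.

Lemma val_sub_neq0 x y : x != y -> 0 < enorm (val x - val y).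
Proof. by move=> xy; apply: enorm_gt0; rewrite subr_eq0. Qed.

Lemma lipb_norm_le f M : 0 <= M -> (forall x, `|f x| <= M) ->
  (forall x y, `|f x - f y| <= M * enorm (val x - val y)) -> lipb_norm f <= M.
Proof.
move=> M0 fM fL; rewrite /lipb_norm ge_max; apply/andP; split.
  rewrite /sup_norm; set A := [set _ | _ in _].
  have [->|/set0P A0] := eqVneq A set0; first by rewrite sup0.
  by apply: ge_sup => // _ [x _ <-].
rewrite /lip_const; set A := [set _ | _ in _].
have [->|/set0P A0] := eqVneq A set0; first by rewrite sup0.
apply: ge_sup => // _ [[x y] /= xy <-].
by rewrite ler_pdivrMr ?val_sub_neq0.
Qed.

Lemma le_lipb_norm f x : `|f x| <= lipb_norm f.
Proof.
rewrite /lipb_norm le_max; apply/orP; left; apply: ub_le_sup; last by exists x.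
by have [[M fM] _] := lipbP f; exists M => _ [y _ <-].
Qed.

Lemma lipschitz_lipb_norm f x y : `|f x - f y| <= lipb_norm f * enorm (val x - val y).
Proof.
have [->|xy] := eqVneq x y.
  by rewrite subrr normr0 mulr_ge0 ?enorm_ge0// (le_trans _ (le_lipb_norm f y)).
have xy0 := val_sub_neq0 xy.
rewrite -ler_pdivrMr// /lipb_norm le_max; apply/orP; right.
apply: ub_le_sup; last by exists (x, y).
have [_ [L fL]] := lipbP f; exists L => _ [[u v] /= uv <-].
by rewrite ler_pdivrMr ?val_sub_neq0.
Qed.

Lemma lipb_norm_ge0 f : 0 <= lipb_norm f.
Proof.
have [[x]|noX] := pselect (inhabited X).
  exact: le_trans (le_lipb_norm f x).
rewrite /lipb_norm le_max; apply/orP; left; rewrite /sup_norm.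
set A := [set _ | _ in _]; suff -> : A = set0 by rewrite sup0.
by rewrite -subset0 => t [x _ _]; exfalso; apply: noX; constructor.
Qed.

Lemma lipb_normB f g : lipb_norm (f - g) <= lipb_norm f + lipb_norm g.
Proof.
apply: lipb_norm_le => [|x|x y]; first by rewrite addr_ge0 ?lipb_norm_ge0.
  rewrite lipbB; apply: le_trans (ler_normB _ _) _.
  by apply: lerD; exact: le_lipb_norm.
rewrite !lipbB (_ : _ - _ = (f x - f y) - (g x - g y)); last by ring.
apply: le_trans (ler_normB _ _) _; rewrite mulrDl.
by apply: lerD; exact: lipschitz_lipb_norm.
Qed.

Lemma lipb_normZ a f : lipb_norm (a *: f) <= `|a| * lipb_norm f.
Proof.
apply: lipb_norm_le => [|x|x y]; first by rewrite mulr_ge0 ?lipb_norm_ge0.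
  rewrite -[(a *: f) x]/(a * f x) normrM ler_wpM2l//; exact: le_lipb_norm.
rewrite -[(a *: f) x]/(a * f x) -[(a *: f) y]/(a * f y) -mulrBr normrM -mulrA.
by rewrite ler_wpM2l//; exact: lipschitz_lipb_norm.
Qed.

Lemma lipb_norm_l1 f x y : `|f x - f y| <= lipb_norm f * l1norm (val x - val y).
Proof.
apply: le_trans (lipschitz_lipb_norm f x y) _.
by rewrite ler_wpM2l ?lipb_norm_ge0// enorm_le_l1norm.
Qed.

End lipb_norm.

(** * The normal trace of Lipschitz boundary values *)

Section boundary_functional.
Context {R : realType} {n : nat}.
Variables (Omega : set 'rV[R]_n) (F : 'I_n -> signed_measure R n)
  (nu : signed_measure R n) (E : set (Borel R n)).
Hypotheses (Omega_open : open Omega) (F_nu : is_divergence Omega F nu).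
Hypotheses (mE : measurable E) (E_sub : E `<=` Omega).

Local Notation X := (boundary (E : set 'rV[R]_n)).
Local Notation tr := (normal_trace F nu E).
Implicit Types (phi : 'rV[R]_n -> R) (psi : Lipb X).

(** [phi] approximates [psi] within [d] on the part of the boundary with squared norm at most
    [1 / d].  It is expressed with nearby points of Omega, since [phi] need not be meaningful
    on the boundary itself. *)
Definition boundary_approx (K d : R) phi psi := C1_le Omega K phi /\
  forall x : X, sqnorm (val x) <= d^-1 ->
    \forall y \near within Omega (nbhs (val x)), `|phi y - psi x| < d.

Definition boundary_cvg (K : R) (phi_ : nat -> 'rV[R]_n -> R) psi :=
  forall d : R, 0 < d -> \forall k \near \oo, boundary_approx K d (phi_ k) psi.

Lemma C1_le_weaken (K L : R) phi : K <= L -> C1_le Omega K phi -> C1_le Omega L phi.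
Proof.
move=> KL [C phiK dphiK]; split => // [x Ox|i x Ox].
  exact: le_trans (phiK x Ox) KL.
exact: le_trans (dphiK i x Ox) KL.
Qed.

Lemma boundary_cvg_const phi psi : C1b Omega phi -> is_restriction Omega phi psi ->
  exists K, boundary_cvg K (fun=> phi) psi.
Proof.
move=> Cphi phipsi; have [K _ c] := C1b_C1_le Cphi; exists K => d d0.
apply: nearW => k; split => // x _.
by have /cvgrPdist_lt/(_ d d0) := phipsi x; apply: filterS => y; rewrite distrC.
Qed.

(** [normal_trace_boundary] applied to [phi - phi']. *)
Lemma trace_diff_small (K L e : R) : 0 < e -> exists2 d : R, 0 < d &
  forall phi phi' psi psi', boundary_approx K d phi psi -> boundary_approx L d phi' psi' ->
    (forall x : X, sqnorm (val x) <= d^-1 -> `|psi x - psi' x| <= d) ->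
    `|tr phi - tr phi'| <= e.
Proof.
move=> e0; have KL0 : 0 <= `|K| + `|L| by rewrite addr_ge0.
have [d d0 dP] := normal_trace_boundary Omega_open F_nu mE E_sub KL0 e0.
have d30 : 0 < d / 3 by rewrite divr_gt0.
have d3 : d^-1 <= (d / 3)^-1.
  by rewrite lef_pV2 ?posrE//; lra.
exists (d / 3) => // phi phi' psi psi' [c cpsi] [c' cpsi'] psid.
have c1 := C1_le_weaken (ler_norm K) c; have c1' := C1_le_weaken (ler_norm L) c'.
rewrite -(normal_traceB F nu Omega_open mE E_sub c1 c1').
apply: dP; first exact: C1_leB.
move=> x Ex xd; have xd3 := le_trans xd d3.
pose x' : X := SigSub (mem_set Ex : x \in X).
have h1 := cpsi x' xd3; have h2 := cpsi' x' xd3; have h3 := psid x' xd3.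
apply: filterS2 h1 h2 => y /= h1 h2.
have -> : phi y - phi' y = (phi y - psi x') + (psi x' - psi' x') - (phi' y - psi' x') by ring.
apply: le_lt_trans (ler_normB _ _) _.
have := ler_normD (phi y - psi x') (psi x' - psi' x'); lra.
Qed.

Lemma exists_boundary_cvg psi : exists phi_ : nat -> 'rV[R]_n -> R,
  boundary_cvg ((4 * n%:R + 8) * lipb_norm psi) phi_ psi /\
  (forall k, C1_le setT ((4 * n%:R + 8) * lipb_norm psi) (phi_ k)) /\
  (forall x : X, phi_ k (val x) @[k --> \oo] --> psi x).
Proof.
set K := _ * _.
have ex k : exists phi, C1_le setT K phi /\ forall x : X,
    sqnorm (val x) <= k.+1%:R -> `|phi (val x) - psi x| <= k.+2%:R^-1.
  have [||phi c phipsi] := @C1_approximation _ _ X psi (lipb_norm psi) k.+1%:R k.+2%:R^-1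
    (lipb_norm_ge0 _) _ _ (@le_lipb_norm _ _ _ psi) (@lipb_norm_l1 _ _ _ psi).
  - by rewrite invr_gt0.
  - by [].
  by exists phi.
have [phi_ phiP] := choice ex.
exists phi_; split => [d d0|]; last first.
  split => [k|x]; first by have [] := phiP k.
  apply/cvgrPdist_le => e e0; have [m] := ltr_add_invr e0; rewrite add0r => me.
  near=> k; have [_ phipsi] := phiP k; rewrite distrC.
  have mk : (m <= k)%N by near: k; exists m.
  apply: le_trans (phipsi x _) _.
    apply/ltW/(lt_le_trans (archi_boundP (sqnorm_ge0 _))).
    by rewrite ler_nat ltnW// ltnS; near: k; exists (Num.bound (sqnorm (val x))).
  apply: le_trans (ltW me); rewrite lef_pV2 ?posrE// ler_nat.
  exact: leq_trans mk (leqnSn k).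
have [m] := ltr_add_invr d0; rewrite add0r => md.
near=> k; have [[C phiK dphiK] phipsi] := phiP k.
have mk : (m <= k)%N by near: k; exists m.
have kd : k.+1%:R^-1 < d.
  by apply: le_lt_trans md; rewrite lef_pV2 ?posrE// ler_nat.
split.
  split; [exact: C1_sub C|by move=> x _; exact: phiK|by move=> i x _; exact: dphiK].
move=> x xd; rewrite near_withinE.
have cphi : {for val x, continuous (phi_ k)} by exact: C1_continuous C I.
have xk : `|phi_ k (val x) - psi x| < k.+1%:R^-1.
  apply: le_lt_trans (phipsi x _) _.
    apply: le_trans xd _; rewrite -[leRHS]invrK lef_pV2 ?posrE// ?invr_gt0// ltW//.
  by rewrite ltf_pV2 ?posrE// ltr_nat.
have gap : 0 < d - k.+1%:R^-1 by rewrite subr_gt0.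
have /cvgrPdist_lt/(_ _ gap) := cphi; apply: filterS => y yx _.
apply: le_lt_trans (ler_distD (phi_ k (val x)) _ _) _.
by rewrite -(subrK k.+1%:R^-1 d) ltrD// distrC.
Unshelve. all: by end_near. Qed.

(** By [trace_diff_small] two approximating sequences have close traces, which gives both
    the Cauchy property and the independence of the sequence. *)
Lemma trace_cvg psi : exists r : R, forall K (phi_ : nat -> 'rV[R]_n -> R),
  boundary_cvg K phi_ psi -> tr (phi_ k) @[k --> \oo] --> r.
Proof.
have [phi0 [c0 _]] := exists_boundary_cvg psi; set K0 := _ * _ in c0.
have close K (phi_ : nat -> 'rV[R]_n -> R) (e : R) : boundary_cvg K phi_ psi -> 0 < e ->
    exists2 d : R, 0 < d & (forall phi, boundary_approx K0 d phi psi ->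
      \forall k \near \oo, `|tr phi - tr (phi_ k)| <= e).
  move=> cK e0; have [d d0 dP] := trace_diff_small K0 K e0; exists d => // phi aphi.
  near=> k; apply: (dP _ _ psi psi) => //.
    by near: k; exact: cK.
  by move=> x _; rewrite subrr normr0 ltW.
have : cvg (tr (phi0 k) @[k --> \oo]).
  apply: cauchy_cvg; apply: cauchy_exP => e e0.
  have e20 : 0 < e / 2 by rewrite divr_gt0.
  have [d d0 dP] := close _ _ _ c0 e20.
  have [m _ mP] := c0 d d0.
  exists (tr (phi0 m)); have := dP _ (mP m (leqnn m)).
  apply: filterS => k; rewrite /ball/= => h; apply: le_lt_trans h _; lra.
move=> /cvg_ex[r cr]; exists r => K phi_ cK; apply/cvgrPdist_le => e e0.
have e20 : 0 < e / 2 by rewrite divr_gt0.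
have [d d0 dP] := close _ _ _ cK e20.
have [m /=] : exists m, boundary_approx K0 d (phi0 m) psi /\ `|r - tr (phi0 m)| <= e / 2.
  have /cvgrPdist_le/(_ _ e20) cre := cr; have := filterI (c0 d d0) cre.
  by case=> m _ /(_ m (leqnn m)); exists m.
move=> [am rm]; have := dP _ am; apply: filterS => k km.
have := ler_distD (tr (phi0 m)) r (tr (phi_ k)); lra.
Unshelve. all: by end_near. Qed.

Definition boundary_trace psi : R := projT1 (cid (trace_cvg psi)).

Lemma boundary_trace_cvg K (phi_ : nat -> 'rV[R]_n -> R) psi : boundary_cvg K phi_ psi ->
  tr (phi_ k) @[k --> \oo] --> boundary_trace psi.
Proof. exact: (projT2 (cid (trace_cvg psi))). Qed.

Lemma boundary_traceE phi psi : C1b Omega phi -> is_restriction Omega phi psi ->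
  boundary_trace psi = tr phi.
Proof.
move=> Cphi phipsi; have [K c] := boundary_cvg_const Cphi phipsi.
by have := boundary_trace_cvg c => /(cvg_lim (@Rhausdorff R)) <-; rewrite lim_cst.
Qed.

Lemma boundary_cvg_lin K L a (phi_ phi'_ : nat -> 'rV[R]_n -> R) psi psi' :
  boundary_cvg K phi_ psi -> boundary_cvg L phi'_ psi' ->
  boundary_cvg (`|a| * K + L) (fun k x => a * phi_ k x + phi'_ k x) (a *: psi + psi').
Proof.
move=> c c' d d0; have a1 : 0 < `|a| + 1 by rewrite ltr_wpDl.
pose d1 := d / (`|a| + 1); have d10 : 0 < d1 by rewrite divr_gt0.
have d1d : d1 <= d by rewrite ler_pdivrMr// ler_peMr ?(ltW d0)// lerDr.
near=> k.
have [Ck phipsi] : boundary_approx K d1 (phi_ k) psi by near: k; exact: c.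
have [Ck' phipsi'] : boundary_approx L d1 (phi'_ k) psi' by near: k; exact: c'.
split; first exact: (C1_leD Omega_open (C1_leZ Omega_open a Ck) Ck').
move=> x xd; have xd1 : sqnorm (val x) <= d1^-1.
  by rewrite (le_trans xd)// lef_pV2 ?posrE.
apply: filterS2 (phipsi x xd1) (phipsi' x xd1) => y /= h1 h2.
have -> : a * phi_ k y + phi'_ k y - (a *: psi + psi') x =
    a * (phi_ k y - psi x) + (phi'_ k y - psi' x) by rewrite lipb_lin; ring.
apply: le_lt_trans (ler_normD _ _) _; rewrite normrM.
have -> : d = `|a| * d1 + d1 by rewrite /d1; field; rewrite gt_eqF.
by apply: ler_ltD => //; rewrite ler_wpM2l// ltW.
Unshelve. all: by end_near. Qed.

Lemma boundary_trace_lin a psi psi' :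
  boundary_trace (a *: psi + psi') = a * boundary_trace psi + boundary_trace psi'.
Proof.
have [phi_ [c _]] := exists_boundary_cvg psi.
have [phi'_ [c' _]] := exists_boundary_cvg psi'.
have lim1 := boundary_trace_cvg (boundary_cvg_lin a c c').
have lim2 : a * tr (phi_ k) + tr (phi'_ k) @[k --> \oo] -->
    a * boundary_trace psi + boundary_trace psi'.
  apply: cvgD; last exact: boundary_trace_cvg c'.
  by apply: cvgM; [exact: cvg_cst|exact: boundary_trace_cvg c].
apply: (cvg_unique (@Rhausdorff R)) lim1 _; apply: cvg_trans lim2.
apply: near_eq_cvg; apply: filterS2 (c 1 ltr01) (c' 1 ltr01) => k [Ck _] [Ck' _].
rewrite (normal_traceD F nu Omega_open mE E_sub (C1_leZ Omega_open a Ck) Ck').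
by rewrite (normal_traceZ F nu Omega_open mE E_sub a Ck).
Qed.

Lemma boundary_trace_le psi (phi_ : nat -> 'rV[R]_n -> R) c :
  boundary_cvg ((4 * n%:R + 8) * lipb_norm psi) phi_ psi ->
  (\forall k \near \oo, `|tr (phi_ k)| <= c) -> `|boundary_trace psi| <= c.
Proof.
move=> /boundary_trace_cvg/cvg_norm lim trc.
exact: (cvgr_to_le lim trc).
Qed.

Lemma boundary_trace_bounded : exists2 C : R, 0 <= C &
  forall psi, `|boundary_trace psi| <= C * lipb_norm psi.
Proof.
have [C C0 trC] := normal_trace_bounded F nu Omega_open mE E_sub.
have K0 : 0 <= 4 * n%:R + 8 :> R by rewrite addr_ge0 ?mulr_ge0.
exists (C * (4 * n%:R + 8)) => [|psi]; first by rewrite mulr_ge0.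
have [phi_ [c _]] := exists_boundary_cvg psi.
apply: (boundary_trace_le c); apply: filterS (c 1 ltr01) => k [Ck _].
by rewrite -mulrA; apply: trC => //; rewrite mulr_ge0 ?lipb_norm_ge0.
Qed.

(** Compare the C^1 approximations of [psi] with the zero function. *)
Lemma boundary_trace_small (e : R) : 0 < e -> exists2 d : R, 0 < d &
  forall psi, lipb_norm psi <= 1 ->
    (forall x : X, sqnorm (val x) <= d^-1 -> `|psi x| <= d) -> `|boundary_trace psi| <= e.
Proof.
move=> e0; have [d d0 dP] := trace_diff_small (4 * n%:R + 8) 0 e0.
have K0 : 0 <= 4 * n%:R + 8 :> R by rewrite addr_ge0 ?mulr_ge0.
have C0 : C1_le Omega 0 (fun=> 0).
  by split => [|x _|i x _]; rewrite ?partial_cst ?normr0//; exact: C1_cst.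
have tr0 : tr (fun=> 0) = 0.
  rewrite -[RHS](mul0r (tr (fun=> 0))) -(normal_traceZ F nu Omega_open mE E_sub 0 C0).
  by congr normal_trace; apply/funext => x; rewrite mul0r.
exists d => // psi psi1 psid; have [phi_ [c _]] := exists_boundary_cvg psi.
apply: (boundary_trace_le c); apply: filterS (c d d0) => k [Ck phipsi].
rewrite -[tr _]subr0 -tr0; apply: (dP _ _ psi 0).
- by split => //; apply: C1_le_weaken Ck; rewrite ler_piMr.
- by split => // x _; apply: nearW => y; rewrite subrr normr0.
- by move=> x xd; rewrite subr0; exact: psid.
Qed.

End boundary_functional.

(** * The Arens-Eells space and weak-star continuity *)

Section arens_eells.
Context {R : realType} {n : nat}.
Variable X : set 'rV[R]_n.
Implicit Types (f g psi : Lipb X) (m : Lipb X -> R) (s : seq (R * X)).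

(** Compactness of the intersection of [X] with a closed ball. *)
Lemma finite_net (c d : R) : closed X -> 0 < d -> exists s : seq X,
  forall x : X, sqnorm (val x) <= c -> exists2 p, p \in s & enorm (val x - val p) <= d.
Proof.
move=> cX d0; pose K := X `&` [set x | sqnorm (x - 0) <= c].
have cK : compact K.
  have cB := @compact_sqball R n 0 c.
  apply: (subclosed_compact _ cB); last exact: subIsetr.
  by apply: closedI => //; exact: compact_closed (@norm_hausdorff _ _) cB.
move: cK; rewrite compact_cover.
move=> /(_ X setT (fun p => [set x | sqnorm (x - val p) < d ^+ 2])).
have d20 : 0 < d ^+ 2 by rewrite exprn_gt0.
case=> [p _|x [Xx _]|D _ DK]; first exact: open_sqball.
  exists (SigSub (mem_set Xx : x \in X)) => //=.
  by rewrite subrr /sqnorm big1// => i _; rewrite mxE expr0n.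
exists (finmap.enum_fset D) => x xc.
have [|p Dp xp] := DK (val x); first by split; rewrite /= ?subr0//; exact/set_mem/valP.
exists p => //; rewrite -[leRHS]ger0_norm ?(ltW d0)// -sqrtr_sqr ler_sqrt ?ltW//.
Qed.

Lemma lipb_dual_lin m : lipb_dual m -> forall a f g, m (a *: f + g) = a * m f + m g.
Proof. by move=> [m_lin _] a f g; exact: m_lin. Qed.

Lemma dirac_sum_le s f :
  `|\sum_(p <- s) p.1 * f p.2| <= (\sum_(p <- s) `|p.1|) * lipb_norm f.
Proof.
apply: le_trans (ler_norm_sum _ _ _) _; rewrite mulr_suml; apply: ler_sum => p _.
by rewrite normrM ler_wpM2l// le_lipb_norm.
Qed.

Lemma le_dual_norm m (B C : R) f : (forall a g, m (a *: g) = a * m g) ->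
  (forall g, `|m g| <= C * lipb_norm g) -> 0 < B -> lipb_norm f <= B ->
  `|m f| <= dual_norm m * B.
Proof.
move=> mZ mC B0 fB; rewrite -ler_pdivrMr//.
have -> : `|m f| / B = `|m (B^-1 *: f)|.
  by rewrite mZ normrM normfV (gtr0_norm B0) mulrC.
apply: ub_le_sup.
  exists `|C| => _ [g /= g1 <-]; apply: le_trans (mC g) _.
  apply: (@le_trans _ _ (`|C| * lipb_norm g)).
    by rewrite ler_wpM2r ?lipb_norm_ge0// ler_norm.
  by rewrite ler_piMr.
exists (B^-1 *: f) => //=; apply: le_trans (lipb_normZ _ _) _.
by rewrite normfV (gtr0_norm B0) mulrC ler_pdivrMr// mul1r.
Qed.

(** On the functions that vanish on a fine finite net, [m] is at most [e / 2] times the norm;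
    [finite_hahn_banach] turns this into a combination of Dirac masses close to [m]. *)
Lemma arens_eells_of_small m : closed X -> lipb_dual m ->
  (forall e : R, 0 < e -> exists2 d : R, 0 < d & forall f, lipb_norm f <= 1 ->
    (forall x : X, sqnorm (val x) <= d^-1 -> `|f x| <= d) -> `|m f| <= e) ->
  arens_eells m.
Proof.
move=> cX dm small; split => // e e0; have m_lin := lipb_dual_lin dm.
have e20 : 0 < e / 2 by rewrite divr_gt0.
have [d d0 dP] := small _ e20.
have [s sP] := finite_net d^-1 cX d0.
have [C mC] := dm.2.
have mZ a f : m (a *: f) = a * m f.
  have m0 : m 0 = 0.
    apply/eqP; rewrite -normr_le0; apply: le_trans (mC 0) _.
    have := lipb_normZ 0 (0 : Lipb X); rewrite scale0r normr0 mul0r => l0.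
    have /eqP -> : lipb_norm (0 : Lipb X) == 0 by rewrite eq_le l0 lipb_norm_ge0.
    by rewrite mulr0.
  by rewrite -[a *: f]addr0 m_lin m0 addr0.
have [|||||c cP] := @finite_hahn_banach R (Lipb X) X (fun x f => f x)
  (fun f => e / 2 * lipb_norm f) s m.
- by move=> x a f g; exact: lipb_lin.
- by move=> f g; rewrite -mulrDr ler_wpM2l ?(ltW e20)// lipb_normB.
- by move=> a f; rewrite mulrCA ler_wpM2l ?(ltW e20)// lipb_normZ.
- exact: m_lin.
- move=> f fs; have small1 g : (forall i, i \in s -> g i = 0) -> lipb_norm g <= 1 ->
      `|m g| <= e / 2.
    move=> gs g1; apply: dP => // x /sP[p ps xp].
    rewrite -[g x]subr0 -(gs p ps); apply: le_trans (lipschitz_lipb_norm g x p) _.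
    by apply: le_trans xp; rewrite ler_piMl ?enorm_ge0.
  have [f0|f0] := eqVneq (lipb_norm f) 0.
    by have := mC f; rewrite f0 !mulr0.
  have fp : 0 < lipb_norm f by rewrite lt_neqAle eq_sym f0 lipb_norm_ge0.
  rewrite -ler_pdivrMr//.
  have -> : `|m f| / lipb_norm f = `|m ((lipb_norm f)^-1 *: f)|.
    by rewrite mZ normrM normfV (gtr0_norm fp) mulrC.
  apply: small1 => [i si|]; first by rewrite -[LHS]/(_ * f i) fs ?mulr0.
  by apply: le_trans (lipb_normZ _ _) _; rewrite normfV (gtr0_norm fp) mulVf.
exists (fun f => \sum_(p <- c) p.1 * f p.2); first by exists c.
apply: (@le_lt_trans _ _ (e / 2)); last by lra.
apply: ge_sup.
  exists `|(m \- (fun f => \sum_(p <- c) p.1 * f p.2)) 0|; exists 0 => //=.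
  have := lipb_normZ 0 (0 : Lipb X); rewrite scale0r normr0 mul0r => l0.
  by rewrite (le_trans l0).
move=> _ [f /= f1 <-]; apply: le_trans (cP f) _.
by rewrite ler_piMr// ltW.
Qed.

(** An element of the Arens-Eells space is a limit in norm of combinations of Dirac masses,
    so on bounded sets pointwise convergence suffices. *)
Lemma arens_eells_cvg m (psi_ : nat -> Lipb X) psi (B : R) : arens_eells m ->
  (forall k, lipb_norm (psi_ k - psi) <= B) ->
  (forall x, psi_ k x @[k --> \oo] --> psi x) -> m (psi_ k) @[k --> \oo] --> m psi.
Proof.
move=> [dm mAE] psiB psix; have m_lin := lipb_dual_lin dm; have [C mC] := dm.2.
pose B1 := `|B| + 1; have B10 : 0 < B1 by rewrite ltr_wpDl.
have psiB1 k : lipb_norm (psi_ k - psi) <= B1.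
  by rewrite (le_trans (psiB k))// (le_trans (ler_norm _))// lerDl.
apply/cvgrPdist_le => e e0.
have e10 : 0 < e / (2 * B1) by rewrite divr_gt0 ?mulr_gt0.
have [u [s us] um] := mAE _ e10.
have ucvg : u (psi_ k - psi) @[k --> \oo] --> (0 : R).
  rewrite (_ : (fun k => u (psi_ k - psi)) =
    fun k => \sum_(p <- s) p.1 * (psi_ k p.2 - psi p.2)); last first.
    by apply/funext => k; rewrite us.
  elim: s {us} => [|p t IH].
    rewrite (_ : (fun _ => _) = fun=> 0); first exact: cvg_cst.
    by apply/funext => k; rewrite big_nil.
  rewrite (_ : (fun _ => _) = fun k => p.1 * (psi_ k p.2 - psi p.2) +
      \sum_(p <- t) p.1 * (psi_ k p.2 - psi p.2)); last first.
    by apply/funext => k; rewrite big_cons.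
  rewrite -[X in _ --> X]addr0; apply: cvgD; last exact: IH.
  rewrite -(mulr0 p.1) -(subrr (psi p.2)); apply: cvgM; first exact: cvg_cst.
  by apply: cvgB; [exact: psix|exact: cvg_cst].
have e20 : 0 < e / 2 by rewrite divr_gt0.
move/cvgrPdist_le : ucvg => /(_ _ e20); apply: filterS => k.
rewrite sub0r normrN => uk.
pose v := m \- u.
have m0 : m 0 = 0.
  have := m_lin (-1) 0 0; rewrite scaleN1r oppr0 addr0 mulN1r; lra.
have mZ a f : m (a *: f) = a * m f by rewrite -[a *: f]addr0 m_lin m0 addr0.
have uZ a f : u (a *: f) = a * u f.
  by rewrite !us mulr_sumr; apply: eq_bigr => p _; rewrite mulrCA.
have vZ a f : v (a *: f) = a * v f by rewrite /v/= mZ uZ mulrBr.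
have vC f : `|v f| <= (C + \sum_(p <- s) `|p.1|) * lipb_norm f.
  rewrite /v/= us mulrDl; apply: le_trans (ler_normB _ _) _.
  by apply: lerD; [exact: mC|exact: dirac_sum_le].
have vk : `|v (psi_ k - psi)| <= e / 2.
  apply: le_trans (le_dual_norm vZ vC B10 (psiB1 k)) _.
  have -> : e / 2 = e / (2 * B1) * B1 by field; rewrite gt_eqF.
  by rewrite ler_wpM2r ?(ltW B10)// ltW.
have -> : m psi - m (psi_ k) = - (v (psi_ k - psi) + u (psi_ k - psi)).
  rewrite /v/= subrK; have := m_lin (-1) psi (psi_ k).
  by rewrite scaleN1r addrC mulN1r => ->; ring.
rewrite normrN (splitr e); apply: le_trans (ler_normD _ _) _.
exact: lerD.
Qed.

Lemma arens_eells_continuous m : arens_eells m -> continuous (m : weak_star X -> R^o).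
Proof.
move=> AEm f.
pose i : arens_eells (X := X) := SigSub (mem_set AEm : m \in arens_eells (X := X)).
have /cvg_sup/(_ i) : nbhs (f : weak_star X) --> (f : weak_star X) by exact: cvg_id.
move=> fi A mA; apply: fi.
exact: (@initial_continuous _ _ (m : Lipb X -> R^o) f A mA).
Qed.

Lemma weak_star_cvg (psi_ : nat -> Lipb X) psi (B : R) :
  (forall k, lipb_norm (psi_ k - psi) <= B) ->
  (forall x, psi_ k x @[k --> \oo] --> psi x) ->
  (psi_ k : weak_star X) @[k --> \oo] --> (psi : weak_star X).
Proof.
move=> psiB psix; apply/cvg_sup => i.
have AEi : arens_eells (val i) by exact/set_mem/valP.
have mcvg := arens_eells_cvg AEi psiB psix.
move=> A; rewrite nbhsE => -[_ [[U oU <-] Upsi] UA].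
have : nbhs (val i psi : R^o) U by exact: open_nbhs_nbhs.
by move=> /mcvg mU; exact: (filterS (fun k Uk => UA _ Uk) mU).
Qed.

End arens_eells.

(** * Existence and uniqueness *)

Lemma divergenceP {R : realType} {n : nat} (Omega : set 'rV[R]_n)
    (F : 'I_n -> signed_measure R n) :
  DMext Omega F -> is_divergence Omega F (divergence Omega F).
Proof. by move=> [_ h]; rewrite /divergence; case: pselect => // h'; case: cid. Qed.

Lemma closed_boundary {R : realType} {n : nat} (E : set 'rV[R]_n) : closed (boundary E).
Proof.
rewrite /boundary setDE; apply: closedI; first exact: closed_closure.
exact/open_closedC/open_interior.
Qed.

(** A C^1 bound on all of R^n, which is convex, bounds the Lipschitz constant of the
    restriction to any subset. *)
Lemma C1_restriction {R : realType} {n : nat} (X : set 'rV[R]_n) (K : R)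
    (phi : 'rV[R]_n -> R) : 0 <= K -> C1_le setT K phi ->
  exists2 psi : Lipb X, (forall x, psi x = phi (val x)) & lipb_norm psi <= (n%:R + 1) * K.
Proof.
move=> K0 c; have [_ phiK _] := c.
have L (x y : X) : `|phi (val x) - phi (val y)| <= (n%:R * K) * enorm (val x - val y).
  apply: le_trans (C1_le_lipschitz _ _ c) _; rewrite [n%:R * K]mulrC -mulrA.
  by rewrite ler_wpM2l//; exact: l1norm_le_enorm.
have Lphi : (fun x : X => phi (val x)) \in lipb (X := X).
  rewrite inE; split; first by exists K => x; exact: phiK.
  by exists (n%:R * K).
exists (MkLipb Lphi) => //; have nK : 0 <= n%:R * K by rewrite mulr_ge0.
apply: lipb_norm_le => [|x|x y]; first by rewrite mulr_ge0// addr_ge0.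
  by apply: le_trans (phiK _ I) _; rewrite mulrDl mul1r lerDr.
by apply: le_trans (L x y) _; rewrite ler_wpM2r ?enorm_ge0// mulrDl mul1r lerDl.
Qed.

Theorem theorem1p1 (R : realType) (n : nat) (n_ge2 : (2 <= n)%N)
    (Omega : set 'rV[R]_n) (Omega_open : open Omega)
    (F : 'I_n -> signed_measure R n) (F_DM : DMext Omega F)
    (E : set (Borel R n)) (E_borel : measurable E) (E_sub : E `<=` Omega) :
  exists! N : Lipb (boundary E) -> R,
    [/\ lipb_dual N,
        continuous (N : weak_star (boundary E) -> R^o) &
        forall phi : 'rV[R]_n -> R, C1b Omega phi ->
        forall psi : Lipb (boundary E), is_restriction Omega phi psi ->
          N psi = - grad_integral F E phi
                  - charge_integral (divergence Omega F) E phi].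
Proof.
have F_div := divergenceP F_DM.
pose N := boundary_trace Omega_open F_div E_borel E_sub.
have dN : lipb_dual N.
  split; first by move=> a f g; exact: boundary_trace_lin.
  by have [C _ NC] := boundary_trace_bounded Omega_open F_div E_borel E_sub; exists C.
exists N; split; first split => //.
- apply: arens_eells_continuous; apply: arens_eells_of_small => //.
    exact: closed_boundary.
  exact: boundary_trace_small.
- by move=> phi Cphi psi; exact: boundary_traceE.
move=> N' [_ cN' N'E]; apply/funext => psi.
have [phi_ [c [Cphi_ phi_psi]]] := exists_boundary_cvg Omega psi.
set K := _ * _ in c Cphi_.
have K0 : 0 <= K by rewrite mulr_ge0 ?lipb_norm_ge0// addr_ge0 ?mulr_ge0.
have [psi_ psi_E psi_K] : exists2 psi_ : nat -> Lipb (boundary E),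
    (forall k x, psi_ k x = phi_ k (val x)) & forall k, lipb_norm (psi_ k) <= (n%:R + 1) * K.
  have ex k : exists g : Lipb (boundary E),
      (forall x, g x = phi_ k (val x)) /\ lipb_norm g <= (n%:R + 1) * K.
    by have [g gE gK] := C1_restriction (boundary E) K0 (Cphi_ k); exists g.
  by have [psi_ psi_P] := choice ex; exists psi_ => k; have [] := psi_P k.
(* The restrictions of the approximations are bounded in Lip_b and converge pointwise. *)
have psi_cvg : (psi_ k : weak_star (boundary E)) @[k --> \oo] --> (psi : weak_star _).
  apply: (@weak_star_cvg _ _ _ _ _ ((n%:R + 1) * K + lipb_norm psi)) => [k|x].
    by apply: le_trans (lipb_normB _ _) _; rewrite lerD2r.
  by under eq_fun do rewrite psi_E; exact: phi_psi.
have lim1 : N' (psi_ k) @[k --> \oo] --> N' psi := cvg_comp _ _ psi_cvg (cN' psi).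
have lim2 : normal_trace F (divergence Omega F) E (phi_ k) @[k --> \oo] --> N psi.
  exact: boundary_trace_cvg c.
apply: (cvg_unique (@Rhausdorff R)) lim2 _.
rewrite (_ : (fun k => _) = fun k => N' (psi_ k))//; apply/funext => k.
have [[dphi cphi] phiK dphiK] := Cphi_ k.
rewrite (N'E (phi_ k)) //.
  split; first by split => [x _|i x _]; [exact: dphi|exact: cphi].
    by exists K => x _; exact: phiK.
  by move=> i; exists K => x _; exact: dphiK.
move=> x; rewrite psi_E; apply: cvg_within_filter.
exact: (C1_continuous (conj dphi cphi) I).
Qed.
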